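(* Let $A,B$ be finite-dimensional Hilbert spaces, $\mathcal{N}$ a CPTP map from $A$ to $B$, and $\rho^B\in\mathcal{D}(B)$ a density operator. (Achievability) Let $\sigma^A\in\mathcal{S}(\rho^B,\mathcal{N})$. Then for all $\delta,\eta\in(0,1)$ there exists a $(1,\Theta,\epsilon)$-code for quantum covering for the pair $(\rho^B,\mathcal{N})$ such that $$\log\Theta\le\left[-H_{\min}^{\delta}(A_R|B)_{\omega}-2\log\eta\right]^+\quad\text{and}\quad \epsilon\le 8(\delta+\eta),$$ where $\omega^{BA_R}=(\mathcal{N}\otimes\mathrm{id})\Phi_\sigma^{AA_R}$ and $\Phi_\sigma^{AA_R}$ is a purification of $\sigma^A$. (Converse) Moreover, for all $\epsilon\in(0,1)$, every $(1,\Theta,\epsilon)$-code for quantum covering for $(\rho^B,\mathcal{N})$ satisfies $$\log\Theta\ge\inf_{\sigma^A\in\mathcal{S}_\epsilon(\rho^B,\mathcal{N})}\left[-H_{\min}(A_R|B)_{\omega}\right]^+,$$ where for each $\sigma^A$ in the infimum $\omega^{BA_R}=(\mathcal{N}\otimes\mathrm{id})\Phi_\sigma^{AA_R}$ with $\Phi_\sigma^{AA_R}$ a purification of $\sigma^A$.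
   Context: All Hilbert spaces are finite-dimensional, $\log$ is base 2, and $[x]^+=\max(x,0)$. $\mathcal{D}(A)$ is the set of density operators on $A$; $\mathcal{D}_\le(A)$ is the set of positive semidefinite operators on $A$ of trace at most 1. $A_R$ is a reference space isomorphic to $A$. $|\omega|$ denotes the rank of an operator $\omega$. $\mathcal{S}(\rho,\mathcal{N})=\{\sigma\in\mathcal{D}(A):\mathcal{N}(\sigma)=\rho\}$ and $\mathcal{S}_\epsilon(\rho,\mathcal{N})=\{\sigma\in\mathcal{D}(A):\|\rho-\mathcal{N}(\sigma)\|_1\le\epsilon\}$. Covering code: an $(n,\Theta,\epsilon)$-code for quantum covering for $(\rho^B,\mathcal{N})$ is a density operator $\hat\sigma^{A^n}$ on $A^{\otimes n}$ with $|\hat\sigma^{A^n}|=\Theta$ and $\frac12\|(\rho^B)^{\otimes n}-\mathcal{N}^{\otimes n}(\hat\sigma^{A^n})\|_1\le\epsilon$. Min-entropy: for $\rho^{AB}\in\mathcal{D}_\le(A\otimes B)$, $H_{\min}(A|B)_\rho=\sup_{\sigma^B\in\mathcal{D}_\le(B)}\sup\{\lambda\in\mathbb{R}:\rho^{AB}\le 2^{-\lambda}\,\mathbb{1}_A\otimes\sigma^B\}$. Smoothed version: $H_{\min}^{\epsilon}(A|B)_\rho=\max_{\sigma\in\mathscr{B}^\epsilon(\rho)}H_{\min}(A|B)_\sigma$, where $\mathscr{B}^\epsilon(\rho)$ is the set of subnormalized states $\sigma$ on the same space with $P(\sigma,\rho)\le\epsilon$. Here $P(\rho,\sigma)=\sqrt{1-F_\star(\rho,\sigma)}$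 is the purified distance, with $F_\star(\rho,\sigma)=\left[\mathrm{Tr}|\sqrt\rho\sqrt\sigma|+\sqrt{(1-\mathrm{Tr}\rho)(1-\mathrm{Tr}\sigma)}\right]^2$.
   Formalization: In the converse the infimum is taken over S_{2ε}(ρ,N) instead of S_ε(ρ,N): codes are defined with (1/2)‖·‖₁ ≤ ε but S_ε has no factor 1/2, and with S_ε the claim is false (e.g. N = id on a qubit, ρ = I/2, ε = 1/2, code |0><0|). *)

(* Defs.v *)
From mathcomp Require Import all_boot all_order all_algebra.
From mathcomp Require Import complex mxtens.
From mathcomp Require Import boolp classical_sets reals constructive_ereal ereal exp.

Set Implicit Arguments.
Unset Strict Implicit.
Unset Printing Implicit Defensive.

Import Order.TTheory GRing.Theory Num.Theory.
Local Open Scope classical_set_scope.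
Local Open Scope complex_scope.
Local Open Scope ring_scope.

(* A Hilbert space of dimension d is C^d with its standard inner product, and
   operators on it are matrices 'M[R[i]]_d.  The tensor product of C^m and C^n
   is C^(m * n), the basis vector e_i (x) e_j having index mxtens_index (i, j). *)

Section Operators.
Variable R : realType.
Local Notation C := R[i].

Definition adjmx m n (X : 'M[C]_(m, n)) : 'M[C]_(n, m) := map_mx Num.conj X^T.

(* 0 <= z in R[i] entails that z is real. *)
Definition psdmx d (X : 'M[C]_d) : Prop :=
  adjmx X = X /\ forall v : 'cV[C]_d, 0 <= (adjmx v *m X *m v) 0 0.

Definition lemx d (X Y : 'M[C]_d) : Prop := psdmx (Y - X).

Definition density d : set 'M[C]_d := [set X | psdmx X /\ \tr X = 1].

Definition subdensity d : set 'M[C]_d := [set X | psdmx X /\ \tr X <= 1].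

(* Functional calculus; it is the positive square root when X is positive
   semidefinite, the only case in which it is used. *)
Definition sqrtmx d (X : 'M[C]_d) : 'M[C]_d :=
  invmx (spectralmx X) *m diag_mx (map_mx sqrtC (spectral_diag X))
    *m spectralmx X.

Definition absmx d (X : 'M[C]_d) : 'M[C]_d := sqrtmx (adjmx X *m X).

Definition rtr d (X : 'M[C]_d) : R := complex.Re (\tr X).

Definition trnorm d (X : 'M[C]_d) : R := rtr (absmx X).

Definition ptrace2 m n (X : 'M[C]_(m * n)) : 'M[C]_m :=
  \matrix_(i, j) \sum_(k < n) X (mxtens_index (i, k)) (mxtens_index (j, k)).

Definition tensmap a b c d (N : 'M[C]_a -> 'M[C]_b) (M : 'M[C]_c -> 'M[C]_d)
    (X : 'M[C]_(a * c)) : 'M[C]_(b * d) :=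
  \sum_(i < a) \sum_(j < a) \sum_(k < c) \sum_(l < c)
    X (mxtens_index (i, k)) (mxtens_index (j, l)) *:
      tensmx (N (delta_mx i j)) (M (delta_mx k l)).

(* Same recursion as [ntensmx], so that [ntensmap N 1] is convertible to [N]. *)
Fixpoint ntensmap_rec a b (N : 'M[C]_a -> 'M[C]_b) n :
    'M[C]_(a ^ n.+1) -> 'M[C]_(b ^ n.+1) :=
  if n is n'.+1 return 'M[C]_(a ^ n.+1) -> 'M[C]_(b ^ n.+1)
  then tensmap N (@ntensmap_rec a b N n') else N.

Definition ntensmap a b (N : 'M[C]_a -> 'M[C]_b) n :
    'M[C]_(a ^ n) -> 'M[C]_(b ^ n) :=
  if n is n'.+1 return 'M[C]_(a ^ n) -> 'M[C]_(b ^ n)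
  then @ntensmap_rec a b N n' else idfun.

Definition completely_positive a b (N : 'M[C]_a -> 'M[C]_b) : Prop :=
  forall k (X : 'M[C]_(a * k)),
    psdmx X -> psdmx (tensmap N (@idfun 'M[C]_k) X).

Definition trace_preserving a b (N : 'M[C]_a -> 'M[C]_b) : Prop :=
  forall X, \tr (N X) = \tr X.

Definition cptp a b (N : {linear 'M[C]_a -> 'M[C]_b}) : Prop :=
  completely_positive N /\ trace_preserving N.

(* Phi is the projector |phi><phi| of a vector phi of A (x) A_R, A_R = C^a. *)
Definition purification a (sigma : 'M[C]_a) (Phi : 'M[C]_(a * a)) : Prop :=
  (exists phi : 'cV[C]_(a * a), Phi = phi *m adjmx phi) /\
  ptrace2 Phi = sigma.

Definition preimage_states a b (rho : 'M[C]_b) (N : 'M[C]_a -> 'M[C]_b) :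
    set 'M[C]_a :=
  [set sigma | density sigma /\ N sigma = rho].

(* No factor 1/2 here, in contrast with [covering_code]: a one-shot code with
   error eps is an approximate preimage with tolerance 2 * eps, not eps. *)
Definition approx_preimage_states a b (eps : R) (rho : 'M[C]_b)
    (N : 'M[C]_a -> 'M[C]_b) : set 'M[C]_a :=
  [set sigma | density sigma /\ trnorm (rho - N sigma) <= eps].

Definition covering_code a b (rho : 'M[C]_b) (N : 'M[C]_a -> 'M[C]_b)
    (n Theta : nat) (eps : R) (sigmahat : 'M[C]_(a ^ n)) : Prop :=
  [/\ density sigmahat, \rank sigmahat = Theta &
      2^-1 * trnorm (ntensmx rho n - @ntensmap a b N n sigmahat) <= eps].

Definition log2 (x : R) : R := ln x / ln 2.

(* The tensor factors are in the order B (x) A: [Hmin rho] is H_min(A|B), the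
   conditioning system being the first one. *)
Definition Hmin b a (rho : 'M[C]_(b * a)) : \bar R :=
  ereal_sup [set ereal_sup
      [set l%:E | l in [set l : R |
         lemx rho ((2 `^ (- l))%:C *: tensmx sigma (1%:M : 'M[C]_a))]]
    | sigma in @subdensity b].

Definition fidelity d (rho sigma : 'M[C]_d) : R :=
  (trnorm (sqrtmx rho *m sqrtmx sigma)
   + Num.sqrt ((1 - rtr rho) * (1 - rtr sigma))) ^+ 2.

Definition purified_distance d (rho sigma : 'M[C]_d) : R :=
  Num.sqrt (1 - fidelity rho sigma).

Definition pball d (eps : R) (rho : 'M[C]_d) : set 'M[C]_d :=
  [set sigma | subdensity sigma /\ purified_distance sigma rho <= eps].

Definition Hmin_smooth b a (eps : R) (rho : 'M[C]_(b * a)) : \bar R :=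
  ereal_sup [set Hmin sigma | sigma in pball eps rho].

Definition pospart (x : \bar R) : \bar R := maxe x 0%E.

(* For Phi on A (x) A_R, the state (N (x) id)(Phi) on B (x) A_R. *)
Definition channel_output a b (N : 'M[C]_a -> 'M[C]_b) (Phi : 'M[C]_(a * a)) :
    'M[C]_(b * a) :=
  tensmap N (@idfun 'M[C]_a) Phi.

End Operators.

Arguments density {R d}.
Arguments subdensity {R d}.
Arguments ntensmap {R a b} N n X.
Arguments covering_code {R a b} rho N n Theta eps sigmahat.

(* Main.v *)
Require Import Defs.
From mathcomp Require Import all_boot all_order all_algebra.
From mathcomp Require Import complex mxtens.
From mathcomp Require Import boolp classical_sets reals constructive_ereal ereal exp.
From mathcomp Require Import ring lra.

Set Implicit Arguments.
Unset Strict Implicit.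
Unset Printing Implicit Defensive.

Import Order.TTheory GRing.Theory Num.Theory.
Local Open Scope classical_set_scope.
Local Open Scope complex_scope.
Local Open Scope ring_scope.

(* Achievability.  Write Phi = |phi><phi| and let s be a vector of A_R whose
   entries are independent uniform fourth roots of unity.  The compression
   <s|Phi|s> is a rank-one operator on A of mean sigma, and N maps it to
   <s|omega|s>.  The code is the normalized average of Theta independent such
   operators.  For Z <= mu tau (x) 1, with mu = 2^(- H_min), the products
   conj(s_k) s_l (k <> l) being orthonormal, the fluctuation X of the average
   of <s|Z|s> satisfies E tr (X tau^-1 X) <= tr (Z (tau^-1 (x) 1) Z) / Theta
   <= mu / Theta, which bounds its trace norm by AM-GM.  The state omega is
   replaced by the smoothed state Z at a cost of twice their trace distance.

   Converse.  The code itself is an approximate preimage, and a purification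
   Phi of an operator sigma of rank Theta satisfies
   Phi <= Theta (sigma (x) 1), because Phi is supported on A (x) Q for a
   projector Q of rank Theta; it remains to apply N (x) id. *)

(** * Adjoints, real traces, and positive semidefinite matrices with their functional calculus *)

Section PositiveMatrices.
Variable R : realType.
Local Notation C := R[i].

Lemma adjmxE m n (X : 'M[C]_(m, n)) i j : adjmx X i j = Num.conj (X j i).
Proof. by rewrite !mxE. Qed.

Lemma adjmxK m n (X : 'M[C]_(m, n)) : adjmx (adjmx X) = X.
Proof. by apply/matrixP=> i j; rewrite !adjmxE conjCK. Qed.

Lemma adjmxM m n p (X : 'M[C]_(m, n)) (Y : 'M[C]_(n, p)) :
  adjmx (X *m Y) = adjmx Y *m adjmx X.
Proof. by rewrite /adjmx trmx_mul map_mxM. Qed.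

Lemma adjmxD m n (X Y : 'M[C]_(m, n)) : adjmx (X + Y) = adjmx X + adjmx Y.
Proof. by apply/matrixP=> i j; rewrite !mxE rmorphD. Qed.

Lemma adjmxN m n (X : 'M[C]_(m, n)) : adjmx (- X) = - adjmx X.
Proof. by apply/matrixP=> i j; rewrite !mxE rmorphN. Qed.

Lemma adjmxB m n (X Y : 'M[C]_(m, n)) : adjmx (X - Y) = adjmx X - adjmx Y.
Proof. by rewrite adjmxD adjmxN. Qed.

Lemma adjmxZ m n (c : C) (X : 'M[C]_(m, n)) :
  adjmx (c *: X) = Num.conj c *: adjmx X.
Proof. by apply/matrixP=> i j; rewrite !mxE rmorphM. Qed.

Lemma adjmx_sum m n (I : finType) (F : I -> 'M[C]_(m, n)) :
  adjmx (\sum_i F i) = \sum_i adjmx (F i).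
Proof.
by apply/matrixP=> i j; rewrite !(mxE, summxE) rmorph_sum; apply: eq_bigr=> k _;
  rewrite !mxE.
Qed.

Lemma conjc_ofR (c : R) : Num.conj (c%:C) = c%:C :> C.
Proof. exact: conjc_real. Qed.

Lemma adjmxZR m n (c : R) (X : 'M[C]_(m, n)) :
  adjmx (c%:C *: X) = c%:C *: adjmx X.
Proof. by rewrite adjmxZ conjc_ofR. Qed.

Lemma adjmx1 n : adjmx (1%:M : 'M[C]_n) = 1%:M.
Proof. by apply/matrixP=> i j; rewrite !mxE rmorph_nat eq_sym. Qed.

Lemma adjmx_delta m n (i : 'I_m) (j : 'I_n) :
  adjmx (delta_mx i j : 'M[C]_(m, n)) = delta_mx j i.
Proof. by apply/matrixP=> k l; rewrite !mxE rmorph_nat andbC. Qed.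

Lemma psdmx_gram m n (B : 'M[C]_(m, n)) : psdmx (adjmx B *m B).
Proof.
split=> [|v]; first by rewrite adjmxM adjmxK.
rewrite -mulmxA -mulmxA mulmxA -adjmxM mxE sumr_ge0 // => i _.
by rewrite adjmxE mulrC mul_conjC_ge0.
Qed.

Lemma psdmx_conj m n (X : 'M[C]_m) (B : 'M[C]_(m, n)) :
  psdmx X -> psdmx (adjmx B *m X *m B).
Proof.
case=> hX pX; split=> [|v]; first by rewrite !adjmxM adjmxK hX mulmxA.
by have := pX (B *m v); rewrite adjmxM !mulmxA.
Qed.

Lemma psdmxD n (X Y : 'M[C]_n) : psdmx X -> psdmx Y -> psdmx (X + Y).
Proof.
move=> [hX pX] [hY pY]; split=> [|v]; first by rewrite adjmxD hX hY.
by rewrite mulmxDr mulmxDl mxE addr_ge0.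
Qed.

Lemma psdmxZ n (c : R) (X : 'M[C]_n) : 0 <= c -> psdmx X -> psdmx (c%:C *: X).
Proof.
move=> c0 [hX pX]; split=> [|v]; first by rewrite adjmxZR hX.
by rewrite -scalemxAr -scalemxAl mxE mulr_ge0 // ler0c.
Qed.

Lemma psdmx0 n : psdmx (0 : 'M[C]_n).
Proof.
split=> [|v]; last by rewrite mulmx0 mul0mx mxE.
by apply/matrixP=> i j; rewrite !mxE rmorph0.
Qed.

Lemma psdmx1 n : psdmx (1%:M : 'M[C]_n).
Proof. by rewrite -(mulmx1 1%:M) -[X in X *m _]adjmx1; exact: psdmx_gram. Qed.

Lemma psdmx_sum n (I : finType) (F : I -> 'M[C]_n) :
  (forall i, psdmx (F i)) -> psdmx (\sum_i F i).
Proof.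
move=> h; apply: (big_ind (@psdmx R n)); first exact: psdmx0.
  by move=> X Y; exact: psdmxD.
by move=> i _; exact: h.
Qed.

Lemma psdmx_diag_ge0 n (X : 'M[C]_n) i : psdmx X -> 0 <= X i i.
Proof.
case=> _ /(_ (delta_mx i 0)); rewrite adjmx_delta -rowE -colE.
by rewrite !mxE.
Qed.

Lemma psdmx_mxtrace_ge0 n (X : 'M[C]_n) : psdmx X -> 0 <= \tr X.
Proof. by move=> pX; apply: sumr_ge0=> i _; exact: psdmx_diag_ge0. Qed.

Lemma rtr_ge0 n (X : 'M[C]_n) : psdmx X -> 0 <= rtr X.
Proof. by move/psdmx_mxtrace_ge0; rewrite lecE /= => /andP[]. Qed.

Lemma psdmx_mxtrace n (X : 'M[C]_n) : psdmx X -> \tr X = (rtr X)%:C.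
Proof. by move/psdmx_mxtrace_ge0=> h; rewrite /rtr RRe_real // ger0_real. Qed.

Lemma rtrD n (X Y : 'M[C]_n) : rtr (X + Y) = rtr X + rtr Y.
Proof. by rewrite /rtr mxtraceD; case: (\tr X); case: (\tr Y). Qed.

Lemma rtrN n (X : 'M[C]_n) : rtr (- X) = - rtr X.
Proof. by rewrite /rtr -scaleN1r mxtraceZ mulN1r; case: (\tr X). Qed.

Lemma rtrB n (X Y : 'M[C]_n) : rtr (X - Y) = rtr X - rtr Y.
Proof. by rewrite rtrD rtrN. Qed.

Lemma rtrZ n (c : R) (X : 'M[C]_n) : rtr (c%:C *: X) = c * rtr X.
Proof. by rewrite /rtr mxtraceZ; case: (\tr X) => x y /=; rewrite mul0r subr0. Qed.

Lemma rtr_sum n (I : finType) (F : I -> 'M[C]_n) :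
  rtr (\sum_i F i) = \sum_i rtr (F i).
Proof.
by apply: (big_morph (@rtr R n) (@rtrD n)); rewrite /rtr mxtrace0.
Qed.

Lemma rtrC m n (X : 'M[C]_(m, n)) (Y : 'M[C]_(n, m)) :
  rtr (X *m Y) = rtr (Y *m X).
Proof. by rewrite /rtr mxtrace_mulC. Qed.

Lemma mxtrace_adj n (X : 'M[C]_n) : \tr (adjmx X) = Num.conj (\tr X).
Proof. by rewrite rmorph_sum; apply: eq_bigr => i _; rewrite adjmxE. Qed.

Lemma rtr_adj n (X : 'M[C]_n) : rtr (adjmx X) = rtr X.
Proof.
by rewrite /rtr mxtrace_adj; case: (\tr X).
Qed.

Lemma psdmx_diag_mx n (d : 'rV[C]_n) :
  (forall i, 0 <= d 0 i) -> psdmx (diag_mx d).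
Proof.
move=> d0; split=> [|v].
  apply/matrixP=> i j; rewrite !mxE eq_sym; case: eqP=> [->|] /=.
    by rewrite mulr1n conj_Creal // ger0_real.
  by rewrite !mulr0n rmorph0.
rewrite mul_mx_diag mxE sumr_ge0 // => i _.
by rewrite !mxE mulrAC mulr_ge0 // mulrC mul_conjC_ge0.
Qed.

(** A Hermitian matrix is normal, so the spectral theorem applies; each eigenvalue is a diagonal
    entry of the positive matrix P X P', where P' is the adjoint of P. *)
Lemma psdmx_spectral n (X : 'M[C]_n) : psdmx X ->
  let P := spectralmx X in let d := spectral_diag X in
  [/\ X = adjmx P *m diag_mx d *m P, invmx P = adjmx P,
      P *m adjmx P = 1%:M, adjmx P *m P = 1%:M & forall i, 0 <= d 0 i].
Proof.
move=> pX P d.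
have U : P \is unitarymx by exact: spectral_unitarymx.
have aP : map_mx Num.conj P^T = adjmx P by [].
have iP : invmx P = adjmx P by rewrite invmx_unitary.
have PaP : P *m adjmx P = 1%:M by move/unitarymxP: U.
have aPP : adjmx P *m P = 1%:M by exact: mulmx1C.
have nX : X \is normalmx 
  by apply/normalmxP; change (X *m adjmx X = adjmx X *m X); rewrite pX.1.
have XE : X = adjmx P *m diag_mx d *m P.
  by rewrite -iP; exact: (orthomx_spectralP nX).
split=> // i.
have -> : d 0 i = diag_mx d i i by rewrite mxE eqxx.
apply: psdmx_diag_ge0.
have -> : diag_mx d = adjmx (adjmx P) *m X *m adjmx P.
  by rewrite XE adjmxK !mulmxA PaP mul1mx -mulmxA PaP mulmx1.
exact: psdmx_conj.
Qed.

(** Multiplicativity of the functional calculus; square roots, inverses and pseudo-inverses are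
    computed through it. *)
Lemma conj_diag_mxM n (P : 'M[C]_n) (u v : 'rV[C]_n) : P *m adjmx P = 1%:M ->
  adjmx P *m diag_mx u *m P *m (adjmx P *m diag_mx v *m P)
  = adjmx P *m diag_mx (\row_i (u 0 i * v 0 i)) *m P.
Proof.
move=> PaP; rewrite !mulmxA -[adjmx P *m diag_mx u *m P *m adjmx P]mulmxA PaP.
by rewrite mulmx1 -[adjmx P *m diag_mx u *m diag_mx v]mulmxA mulmx_diag.
Qed.

Lemma sqrtmxP n (X : 'M[C]_n) : psdmx X ->
  psdmx (sqrtmx X) /\ sqrtmx X *m sqrtmx X = X.
Proof.
move=> pX; have [XE iP PaP _ d0] := psdmx_spectral pX.
rewrite /sqrtmx iP; split.
  apply: psdmx_conj; apply: psdmx_diag_mx => i; by rewrite mxE sqrtC_ge0.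
rewrite conj_diag_mxM // [RHS]XE; congr (_ *m diag_mx _ *m _).
by apply/rowP=> i; rewrite !mxE -expr2 sqrtCK.
Qed.

(** With q the square root of X, the trace is that of the positive matrix q Y q. *)
Lemma rtr_mul_ge0 n (X Y : 'M[C]_n) : psdmx X -> psdmx Y -> 0 <= rtr (X *m Y).
Proof.
move=> pX pY; have [[hq _] qE] := sqrtmxP pX.
rewrite -qE -mulmxA rtrC -{1}hq; apply: rtr_ge0.
by rewrite -mulmxA mulmxA; exact: psdmx_conj.
Qed.

End PositiveMatrices.

(** * Contractions as test operators for the trace norm, and domination of a difference of states by
    the purified distance *)

Section Contractions.
Variable R : realType.
Local Notation C := R[i].

(** Operator norm at most 1, put as an operator inequality so that positivity arguments apply to
    it. *)
Definition contraction n (V : 'M[C]_n) := lemx (V *m adjmx V) 1%:M.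

(** With V' the adjoint and Z = V' V, one has 1 - Z = (1 - Z)^2 + V' (1 - V V') V. *)
Lemma contraction_adj n (V : 'M[C]_n) :
  contraction V -> contraction (adjmx V).
Proof.
rewrite /contraction /lemx adjmxK => cV.
set Z := adjmx V *m V.
have hZ : adjmx Z = Z by rewrite /Z adjmxM adjmxK.
have -> : 1%:M - Z = adjmx (1%:M - Z) *m (1%:M - Z)
                   + adjmx V *m (1%:M - V *m adjmx V) *m V.
  rewrite adjmxB hZ adjmx1 !(mulmxBl, mulmxBr, mul1mx, mulmx1) !mulmxA -/Z.
  by rewrite -[Z *m _ *m _]mulmxA -/Z; apply/matrixP=> i j; rewrite !mxE; ring.
by apply: psdmxD; [exact: psdmx_gram | exact: psdmx_conj].
Qed.

Lemma contraction1 n : contraction (1%:M : 'M[C]_n).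
Proof. by rewrite /contraction /lemx adjmx1 mulmx1 subrr; exact: psdmx0. Qed.

Lemma contractionN n (V : 'M[C]_n) : contraction V -> contraction (- V).
Proof. by rewrite /contraction adjmxN mulmxN mulNmx opprK. Qed.

(** V is the pseudo-inverse of |X| times the adjoint of X, so that V X = |X|. A trace norm is then
    bounded by testing against all contractions. *)
Lemma trnorm_contraction n (X : 'M[C]_n) :
  exists2 V, contraction V & trnorm X = rtr (V *m X).
Proof.
have pY := psdmx_gram X; have [YE iP PaP aPP d0] := psdmx_spectral pY.
rewrite /trnorm /absmx /sqrtmx iP.
set P := spectralmx _ in YE iP PaP aPP *.
set d := spectral_diag _ in YE d0 *.
(* Since 0^-1 = 0, [g] inverts |X| on its support and vanishes on its kernel. *)
pose g := \row_i (sqrtC (d 0 i))^-1.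
have conjP u v := conj_diag_mxM u v PaP.
exists (adjmx P *m diag_mx g *m P *m adjmx X); last first.
  suff -> : adjmx P *m diag_mx g *m P *m adjmx X *m X
      = adjmx P *m diag_mx (map_mx sqrtC d) *m P by [].
  rewrite -[LHS]mulmxA YE conjP; congr (_ *m diag_mx _ *m _).
  apply/rowP=> i; rewrite !mxE.
  have [->|di0] := eqVneq (d 0 i) 0; first by rewrite sqrtC0 mulr0.
  by rewrite -[X in _ * X]sqrtCK expr2 mulKf // sqrtC_eq0.
have hG : adjmx (adjmx P *m diag_mx g *m P) = adjmx P *m diag_mx g *m P.
  suff [] : psdmx (adjmx P *m diag_mx g *m P) by [].
  by apply/psdmx_conj/psdmx_diag_mx => i; rewrite mxE invr_ge0 sqrtC_ge0.
rewrite /contraction /lemx adjmxM adjmxK hG.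
set G := adjmx P *m diag_mx g *m P.
rewrite mulmxA -[G *m adjmx X *m X]mulmxA YE !conjP.
(* V times its adjoint is diagonal in the basis P with eigenvalues 0 and 1; the identity is written
   in that basis to be compared with it. *)
have -> : 1%:M = adjmx P *m diag_mx (const_mx 1) *m P.
  by rewrite diag_const_mx mulmx1.
rewrite -mulmxBl -mulmxBr -linearB.
apply/psdmx_conj/psdmx_diag_mx => i; rewrite !mxE.
have [->|di0] := eqVneq (d 0 i) 0; first by rewrite mulr0 mul0r subr0 ler01.
by rewrite -[X in _ * X * _]sqrtCK expr2 mulKf ?sqrtC_eq0 // mulfV ?sqrtC_eq0 // subrr.
Qed.

Lemma trnorm_ge0 n (X : 'M[C]_n) : 0 <= trnorm X.
Proof. by apply: rtr_ge0; have [] := sqrtmxP (psdmx_gram X). Qed.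

(** With H = V + V', V' the adjoint, both 2 - H and 2 + H are positive. Pairing the first with D +
    X, the second with D - X, and adding, leaves 4 tr D - 4 Re tr (V X) >= 0. *)
Lemma rtr_contraction_le n (V X D : 'M[C]_n) : contraction V ->
  adjmx X = X -> lemx X D -> lemx (- X) D -> rtr (V *m X) <= rtr D.
Proof.
rewrite /lemx opprK => cV hX DX1 DX2; pose H := V + adjmx V.
have P1 (W : 'M[C]_n) : contraction W ->
    psdmx (1%:M + 1%:M - (W + adjmx W)).
  (* 2 - W - W' = (1 - W)(1 - W') + (1 - W W'), with W' the adjoint. *)
  move=> cW; have -> : 1%:M + 1%:M - (W + adjmx W)
     = adjmx (1%:M - adjmx W) *m (1%:M - adjmx W) + (1%:M - W *m adjmx W).
    rewrite adjmxB adjmxK adjmx1 mulmxBr mulmx1 mulmxBl mul1mx.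
    by apply/matrixP=> i j; rewrite !mxE; ring.
  exact: psdmxD (psdmx_gram _) cW.
have H1 := rtr_mul_ge0 (P1 _ cV) DX2.
have H2 := rtr_mul_ge0 (P1 _ (contractionN cV)) DX1.
have HV : rtr (adjmx V *m X) = rtr (V *m X).
  by rewrite -rtr_adj adjmxM adjmxK hX rtrC.
rewrite adjmxN -opprD opprK in H2.
rewrite !(mulmxBl, mulmxBr, mulmxDl, mulmxDr, mul1mx, rtrD, rtrB, rtrN, HV) in H1 H2.
move: H1 H2; rewrite !(mulNmx, mulmxDl, rtrD, rtrN, HV); lra.
Qed.

Lemma rtr_contraction_psd n (V X : 'M[C]_n) :
  contraction V -> psdmx X -> rtr (V *m X) <= rtr X.
Proof.
move=> cV pX; apply: (rtr_contraction_le cV pX.1); rewrite /lemx.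
  by rewrite subrr; exact: psdmx0.
by rewrite opprK; exact: psdmxD.
Qed.

(** Expand c^-1 (E - c F)(E - c F)', the prime denoting the adjoint. *)
Lemma psdmx_young m n (c : R) (E F : 'M[C]_(m, n)) : 0 < c ->
  psdmx (c^-1%:C *: (E *m adjmx E) + c%:C *: (F *m adjmx F)
         - (E *m adjmx F + F *m adjmx E)).
Proof.
move=> c0.
have -> : c^-1%:C *: (E *m adjmx E) + c%:C *: (F *m adjmx F)
         - (E *m adjmx F + F *m adjmx E)
   = c^-1%:C *: (adjmx (adjmx (E - c%:C *: F)) *m adjmx (E - c%:C *: F)).
  rewrite adjmxK adjmxB adjmxZR mulmxBl !mulmxBr -!scalemxAl -!scalemxAr.
  apply/matrixP=> i j; rewrite !mxE.
  have c1 : c%:C * c^-1%:C = 1 :> C by rewrite -rmorphM /= mulfV ?gt_eqF.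
  by ring: c1.
by apply: psdmxZ; [rewrite invr_ge0 ltW | exact: psdmx_gram].
Qed.

(** A negative x has square root 0 by convention; x will be 1 minus a fidelity, whose sign is not
    established. *)
Lemma ler_sqrt_sqr (x y : R) : Num.sqrt x <= y -> x <= y ^+ 2.
Proof.
move=> xy; have [x0|x0] := leP 0 x; last by rewrite (le_trans (ltW x0)) ?sqr_ge0.
by rewrite -(sqr_sqrtr x0) lerXn2r ?nnegrE // ?sqrtr_ge0 // (le_trans _ xy) ?sqrtr_ge0.
Qed.

(** Here f is the root of the fidelity, s and p the traces of sigma and of an operator below rho.
    The choice of c makes c (2 + 2 f) equal to 2 delta and c^-1 (2 - 2 f) at most 2 delta, while 1 -
    p <= 2 (1 - f) <= 2 delta. *)
Lemma fuchs_scalar (delta s p f : R) : 0 < delta < 1 -> 0 <= f ->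
  1 - f ^+ 2 <= delta ^+ 2 -> s <= 1 -> p <= 1 -> 0 <= s + p - 2 * f ->
  let c := delta / (1 + f) in
  [/\ 0 < c & 2^-1 * (c^-1 * (s + p - 2 * f) + c * (s + p + 2 * f)) + (1 - p)
      <= 4 * delta].
Proof.
move=> /andP[d0 d1] f0 fd s1 p1 E0 c.
have f1 : f <= 1 by lra.
have f10 : 0 < 1 + f by lra.
have c0 : 0 < c by rewrite divr_gt0.
split=> //.
have B1 : c^-1 * (s + p - 2 * f) <= c^-1 * (2 - 2 * f).
  by rewrite ler_pM2l ?invr_gt0 //; lra.
have B2 : c * (s + p + 2 * f) <= c * (2 + 2 * f).
  by rewrite ler_pM2l //; lra.
have B3 : c * (2 + 2 * f) = 2 * delta by rewrite /c; field; rewrite gt_eqF.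
have B4 : c^-1 * (2 - 2 * f) <= 2 * delta.
  have -> : c^-1 * (2 - 2 * f) = 2 * (1 - f ^+ 2) / delta.
    by rewrite /c; field; rewrite !gt_eqF.
  by rewrite ler_pdivrMr //; move: fd; rewrite !expr2; lra.
have B5 : 1 - f <= delta.
  have : f ^+ 2 <= f by rewrite expr2 ler_piMr.
  have : delta ^+ 2 <= delta by rewrite expr2 ler_piMr // ltW.
  by move: fd; lra.
lra.
Qed.

(* A lossy Fuchs-van de Graaf inequality: the constant 2 would require the
   polar decomposition with a unitary factor, 4 only needs a contraction. *)
Lemma purified_distance_dominated n (delta : R) (sigma rho : 'M[C]_n) :
  0 < delta < 1 -> psdmx sigma -> psdmx rho -> rtr sigma <= 1 -> rtr rho = 1 ->
  purified_distance sigma rho <= delta ->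
  exists D, [/\ lemx (sigma - rho) D, lemx (- (sigma - rho)) D
              & rtr D <= 4 * delta].
Proof.
move=> d01 ps pr ts tr1 /ler_sqrt_sqr.
rewrite /fidelity tr1 subrr mulr0 sqrtr0 addr0.
move: (sqrtmx sigma) (sqrtmxP ps) => a [[ha _] aE].
move: (sqrtmx rho) (sqrtmxP pr) => q [[hq _] qE].
have := trnorm_ge0 (a *m q); have [V cV ->] := trnorm_contraction (a *m q).
have [f fE] : exists f, f = rtr (V *m (a *m q)) by eexists.
rewrite -fE => f0 fd.
(* P replaces q, the root of rho, by a factor aligned with a, the root of sigma: tr (P a) = f, and P
   P' <= rho because V is a contraction. *)
have [P PE] : exists P, P = q *m V by eexists.
have aP : adjmx P = adjmx V *m q by rewrite PE adjmxM hq.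
have fE1 : rtr (P *m a) = f by rewrite fE PE -mulmxA rtrC -mulmxA.
have fE2 : rtr (a *m adjmx P) = f.
  by rewrite -fE1 -[LHS]rtr_adj adjmxM adjmxK ha.
have [D2 D2E pD2] : exists2 D2, D2 = rho - P *m adjmx P & psdmx D2.
  exists (adjmx q *m (1%:M - V *m adjmx V) *m q); last exact: psdmx_conj.
  by rewrite hq mulmxBr mulmxBl mulmx1 qE aP PE -!mulmxA.
have [p pE] : exists p, p = rtr (P *m adjmx P) by eexists.
have tD2 : rtr D2 = 1 - p by rewrite D2E rtrB tr1 pE.
have aPP : adjmx (a - P) = a - adjmx P by rewrite adjmxB ha.
have aPP' : adjmx (a + P) = a + adjmx P by rewrite adjmxD ha.
have trE : rtr ((a - P) *m adjmx (a - P)) = rtr sigma + p - 2 * f.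
  rewrite aPP mulmxBl !mulmxBr aE !rtrB fE1 fE2 -pE.
  by move: (rtr sigma); clear; move=> x; ring.
have trF : rtr ((a + P) *m adjmx (a + P)) = rtr sigma + p + 2 * f.
  rewrite aPP' mulmxDl !mulmxDr aE !rtrD fE1 fE2 -pE.
  by move: (rtr sigma); clear; move=> x; ring.
have pEE : psdmx ((a - P) *m adjmx (a - P)).
  by rewrite -{1}[a - P]adjmxK; exact: psdmx_gram.
have := rtr_ge0 pEE; rewrite trE => E0.
have := rtr_ge0 pD2; rewrite tD2 => D20.
have p1 : p <= 1 by rewrite -subr_ge0.
have [c0 bound] := fuchs_scalar d01 f0 fd ts p1 E0.
have [c cE] : exists c, c = delta / (1 + f) by eexists.
rewrite -cE in c0 bound.
have [G GE] : exists G, G = sigma - P *m adjmx P by eexists.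
(* Young's inequality is used with E = a - P and F = a + P, whose cross terms add up to 2 G. *)
have EFE : (a - P) *m adjmx (a + P) + (a + P) *m adjmx (a - P) = G + G.
  rewrite aPP aPP' !(mulmxBl, mulmxDl, mulmxBr, mulmxDr) aE GE.
  move: (a *m _) (P *m a) (P *m _); clear => A1 A2 A3.
  apply/matrixP=> i j; rewrite !mxE.
  by move: (A1 i j) (A2 i j) (A3 i j) (sigma i j); clear; move=> *; ring.
have half (X : 'M[C]_n) : 2^-1%:C *: (X + X) = X.
  rewrite -mulr2n -scaler_nat scalerA.
  have -> : 2^-1%:C * 2 = 1 :> C.
    by rewrite -(rmorph_nat (real_complex R) 2) -rmorphM mulVf // pnatr_eq0.
  exact: scale1r.
have h0 : 0 <= 2^-1 :> R by rewrite invr_ge0 ler0n.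
have [D1 D1E] : exists D1, D1 = 2^-1%:C *: (c^-1%:C *: ((a - P) *m adjmx (a - P))
    + c%:C *: ((a + P) *m adjmx (a + P))) by eexists.
have D1G : psdmx (D1 - G).
  by rewrite -[G]half -EFE D1E -scalerBr; exact: psdmxZ h0 (psdmx_young _ _ c0).
have D1G' : psdmx (D1 + G).
  have := psdmx_young (a - P) (- (a + P)) c0.
  rewrite adjmxN mulmxN !mulNmx mulmxN !opprK -opprD opprK EFE.
  by move/(psdmxZ h0); rewrite scalerDr (half G) -D1E; apply.
(* sigma - rho = G - D2, where D1 dominates both G and - G, and D2 is positive. *)
exists (D1 + D2); rewrite /lemx; split.
- have -> : D1 + D2 - (sigma - rho) = (D1 - G) + (D2 + D2).
    rewrite D2E GE; move: (D1) (P *m adjmx P) (sigma) (rho); clear=> A1 A2 A3 A4.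
    by apply/matrixP=> i j; rewrite !mxE; ring.
  exact: psdmxD D1G (psdmxD pD2 pD2).
- have -> : D1 + D2 - - (sigma - rho) = D1 + G.
    rewrite D2E GE; move: (D1) (P *m adjmx P) (sigma) (rho); clear=> A1 A2 A3 A4.
    by apply/matrixP=> i j; rewrite !mxE; ring.
  exact: D1G'.
by rewrite rtrD D1E rtrZ rtrD !rtrZ trE trF tD2.
Qed.

End Contractions.

(** * Blocks over the second tensor factor, compressions, and weighted trace inequalities *)

Section Blocks.
Variable R : realType.
Local Notation C := R[i].

Lemma big_mxtens m n (V : nmodType) (F : 'I_(m * n) -> V) :
  \sum_x F x = \sum_i \sum_k F (mxtens_index (i, k)).
Proof.
rewrite pair_big /=; apply: (reindex (fun p => mxtens_index (p.1, p.2))).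
exists (@mxtens_unindex m n) => [[i k]|x] _ /=; first exact: mxtens_indexK.
exact: mxtens_unindexK.
Qed.

(** Z is the sum over k, l of this block tensored with |k><l|. *)
Definition mxblk b a (Z : 'M[C]_(b * a)) (k l : 'I_a) : 'M[C]_b :=
  \matrix_(i, j) Z (mxtens_index (i, k)) (mxtens_index (j, l)).

Lemma mxblkM b a (X Y : 'M[C]_(b * a)) k l :
  mxblk (X *m Y) k l = \sum_m mxblk X k m *m mxblk Y m l.
Proof.
apply/matrixP=> i j; rewrite mxE mxE big_mxtens exchange_big summxE /=.
by apply: eq_bigr=> m _; rewrite mxE; apply: eq_bigr=> n _; rewrite !mxE.
Qed.

Lemma mxblk_adj b a (X : 'M[C]_(b * a)) k l :
  mxblk (adjmx X) k l = adjmx (mxblk X l k).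
Proof. by apply/matrixP=> i j; rewrite !mxE. Qed.

Lemma mxblk_tens1 b a (K : 'M[C]_b) k l :
  mxblk (tensmx K (1%:M : 'M[C]_a)) k l = (k == l)%:R *: K.
Proof. by apply/matrixP=> i j; rewrite mxE tensmxE !mxE mulrC. Qed.

Lemma mxblkP b a (X Y : 'M[C]_(b * a)) :
  (forall k l, mxblk X k l = mxblk Y k l) -> X = Y.
Proof.
move=> XY; apply/matrixP=> x y.
case: (mxtens_indexP x) => i k; case: (mxtens_indexP y) => j l.
by move/matrixP/(_ i j): (XY k l); rewrite !mxE.
Qed.

Lemma tensmx11 b a : tensmx (1%:M : 'M[C]_b) (1%:M : 'M[C]_a) = 1%:M.
Proof.
apply: mxblkP=> k l; rewrite mxblk_tens1; apply/matrixP=> i j; rewrite !mxE.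
rewrite (can_eq (@mxtens_indexK _ _)) xpair_eqE.
by case: (k == l); rewrite (mul1r, mul0r) (andbT, andbF).
Qed.

Lemma adjmx_tens1 b a (K : 'M[C]_b) :
  adjmx (tensmx K (1%:M : 'M[C]_a)) = tensmx (adjmx K) 1%:M.
Proof.
apply: mxblkP=> k l; rewrite mxblk_adj !mxblk_tens1 adjmxZ eq_sym.
by rewrite rmorph_nat.
Qed.

Lemma ptrace2_blk b a (Z : 'M[C]_(b * a)) : ptrace2 Z = \sum_k mxblk Z k k.
Proof.
by apply/matrixP=> i j; rewrite summxE mxE; apply: eq_bigr=> k _; rewrite !mxE.
Qed.

Lemma mxtrace_ptrace2 b a (Z : 'M[C]_(b * a)) : \tr (ptrace2 Z) = \tr Z.
Proof.
by rewrite [RHS]big_mxtens /=; apply: eq_bigr=> i _; rewrite !mxE.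
Qed.

Lemma rtr_ptrace2 b a (Z : 'M[C]_(b * a)) : rtr (ptrace2 Z) = rtr Z.
Proof. by rewrite /rtr mxtrace_ptrace2. Qed.

(** In the expansion into matrix units, only the unit |i><j| of the second factor reaches the block
    (i, j); what remains is N by linearity. *)
Lemma tensmap_blk a b k (N : {linear 'M[C]_a -> 'M[C]_b})
    (X : 'M[C]_(a * k)) i j :
  mxblk (tensmap N (@idfun 'M[C]_k) X) i j = N (mxblk X i j).
Proof.
rewrite /tensmap [mxblk X i j]matrix_sum_delta raddf_sum.
apply/matrixP=> p q; rewrite mxE !summxE; apply: eq_bigr=> i' _.
rewrite raddf_sum !summxE; apply: eq_bigr=> j' _.
rewrite summxE (bigD1 i) //= [X in _ + X]big1 ?addr0; last first.
  move=> k' kk'; rewrite summxE big1 // => l' _.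
  by rewrite mxE tensmxE [delta_mx k' l' i j]mxE eq_sym (negPf kk') !mulr0.
rewrite summxE (bigD1 j) //= [X in _ + X]big1 ?addr0; last first.
  move=> l' ll'.
  rewrite mxE tensmxE [delta_mx i l' i j]mxE [j == l']eq_sym (negPf ll').
  by rewrite andbF !mulr0.
by rewrite mxE tensmxE [delta_mx i j i j]mxE !eqxx mulr1 linearZ !mxE.
Qed.

(* 1 (x) |s> : C^b -> C^b (x) C^a. *)
Definition tens_vec b a (s : 'I_a -> C) : 'M[C]_(b * a, b) :=
  \matrix_(x, j) (((mxtens_unindex x).1 == j)%:R * s (mxtens_unindex x).2).

(** The partial matrix element <s|Z|s>. *)
Definition compress b a (s : 'I_a -> C) (Z : 'M[C]_(b * a)) : 'M[C]_b :=
  adjmx (tens_vec b s) *m Z *m tens_vec b s.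

Lemma compressE b a (s : 'I_a -> C) (Z : 'M[C]_(b * a)) :
  compress s Z = \sum_k \sum_l (Num.conj (s k) * s l) *: mxblk Z k l.
Proof.
apply/matrixP=> i j; rewrite mxE big_mxtens (bigD1 j) //= [X in _ + X]big1 ?addr0.
  rewrite [in RHS]exchange_big /= summxE; apply: eq_bigr=> l _.
  rewrite mxE big_mxtens (bigD1 i) //= [X in _ + X]big1 ?addr0.
    rewrite summxE mulr_suml; apply: eq_bigr=> k _.
    by rewrite !mxE !mxtens_indexK /= !eqxx !mul1r mulrAC.
  move=> i' ii'; rewrite big1 // => k _.
  by rewrite !mxE !mxtens_indexK /= (negPf ii') mul0r rmorph0 mul0r.
move=> j' jj'; rewrite big1 // => l _.
by rewrite [X in _ * X]mxE mxtens_indexK /= (negPf jj') mul0r mulr0.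
Qed.

Lemma compress_psd b a (s : 'I_a -> C) (Z : 'M[C]_(b * a)) :
  psdmx Z -> psdmx (compress s Z).
Proof. exact: psdmx_conj. Qed.

Lemma compress_adj b a (s : 'I_a -> C) (Z : 'M[C]_(b * a)) :
  adjmx (compress s Z) = compress s (adjmx Z).
Proof. by rewrite /compress !adjmxM adjmxK mulmxA. Qed.

Lemma compressB b a (s : 'I_a -> C) (Y Z : 'M[C]_(b * a)) :
  compress s (Y - Z) = compress s Y - compress s Z.
Proof. by rewrite /compress mulmxBr mulmxBl. Qed.

(** Diagonal blocks are compressions by basis vectors, hence inherit positivity. *)
Lemma compress_delta b a (Z : 'M[C]_(b * a)) k :
  compress (fun l => (l == k)%:R) Z = mxblk Z k k.
Proof.
rewrite compressE (bigD1 k) //= [X in _ + X]big1 ?addr0; last first.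
  by move=> l lk; rewrite big1 // => m _; rewrite (negPf lk) rmorph0 mul0r scale0r.
rewrite (bigD1 k) //= [X in _ + X]big1 ?addr0; last first.
  by move=> l lk; rewrite (negPf lk) mulr0 scale0r.
by rewrite eqxx rmorph1 mulr1 scale1r.
Qed.

Lemma ptrace2_psd b a (Z : 'M[C]_(b * a)) : psdmx Z -> psdmx (ptrace2 Z).
Proof.
move=> pZ; rewrite ptrace2_blk; apply: psdmx_sum => k.
by rewrite -compress_delta; exact: compress_psd.
Qed.

Lemma ptrace2B b a (Y Z : 'M[C]_(b * a)) : ptrace2 (Y - Z) = ptrace2 Y - ptrace2 Z.
Proof.
by apply/matrixP=> i j; rewrite !mxE -sumrB; apply: eq_bigr=> k _; rewrite !mxE.
Qed.

Lemma ptrace2N b a (Z : 'M[C]_(b * a)) : ptrace2 (- Z) = - ptrace2 Z.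
Proof.
by apply/matrixP=> i j; rewrite !mxE -sumrN; apply: eq_bigr=> k _; rewrite !mxE.
Qed.

Lemma ptrace2_adj b a (Z : 'M[C]_(b * a)) : ptrace2 (adjmx Z) = adjmx (ptrace2 Z).
Proof.
by apply/matrixP=> i j; rewrite !mxE rmorph_sum; apply: eq_bigr=> k _; rewrite !mxE.
Qed.

(** The weighted square norm of Z is the sum of those of its blocks, the form in which the second
    moment of random block sums appears. *)
Lemma rtr_tens_sandwich b a (K : 'M[C]_b) (Z : 'M[C]_(b * a)) :
  rtr (adjmx Z *m tensmx K 1%:M *m Z)
  = \sum_k \sum_l rtr (adjmx (mxblk Z k l) *m K *m mxblk Z k l).
Proof.
rewrite -rtr_ptrace2 ptrace2_blk rtr_sum exchange_big /=.
apply: eq_bigr=> l _; rewrite mxblkM rtr_sum; apply: eq_bigr=> k _.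
congr (rtr (_ *m _)); rewrite mxblkM (bigD1 k) //= [X in _ + X]big1 ?addr0.
  by rewrite mxblk_tens1 eqxx scale1r mxblk_adj.
by move=> m mk; rewrite mxblk_tens1 (negPf mk) scale0r mulmx0.
Qed.

(** The weight tau may be singular, so it is shifted before being inverted. *)
Lemma psdmx_inv_shift n (tau : 'M[C]_n) (c : R) : psdmx tau -> 0 < c ->
  exists2 K, psdmx K & K *m (tau + c%:C%:M) = 1%:M.
Proof.
move=> pt c0; have [tE _ PaP aPP d0] := psdmx_spectral pt.
move: (spectralmx tau) (spectral_diag tau) tE PaP aPP d0 => P d tE PaP aPP d0.
have dc i : 0 < d 0 i + c%:C by rewrite ltr_wpDl // ltcR.
exists (adjmx P *m diag_mx (\row_i (d 0 i + c%:C)^-1) *m P).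
  by apply/psdmx_conj/psdmx_diag_mx=> i; rewrite mxE invr_ge0 ltW.
have -> : tau + c%:C%:M = adjmx P *m diag_mx (\row_i (d 0 i + c%:C)) *m P.
  have -> : diag_mx (\row_i (d 0 i + c%:C)) = diag_mx d + c%:C%:M.
    apply/matrixP=> i j; rewrite !mxE.
    by case: (i == j); rewrite ?mulr1n ?mulr0n ?addr0.
  by rewrite mulmxDr mulmxDl -tE mul_mx_scalar -scalemxAl aPP scalemx1.
rewrite conj_diag_mxM //.
rewrite (_ : (\row_i _) = const_mx 1); last first.
  by apply/rowP=> i; rewrite !mxE mulVf // gt_eqF.
by rewrite diag_const_mx mulmx1.
Qed.

(** With B = K A and B' its adjoint, A - A K A = (1 - B)' A (1 - B) + B' (T - A) B. *)
Lemma psdmx_schur n (A T K : 'M[C]_n) : psdmx A -> lemx A T -> adjmx K = K ->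
  K *m T = 1%:M -> lemx (A *m K *m A) A.
Proof.
move=> pA AT hK KT; have hA := pA.1.
have TK : T *m K = 1%:M by exact: mulmx1C.
have [B BE] : exists B, B = K *m A by eexists.
have aB : adjmx B = A *m K by rewrite BE adjmxM hK hA.
have AB : A *m B = A *m K *m A by rewrite BE mulmxA.
have BA : adjmx B *m A = A *m K *m A by rewrite aB.
have BTB : adjmx B *m T *m B = A *m K *m A.
  by rewrite aB BE -!mulmxA [T *m _]mulmxA TK mul1mx.
rewrite /lemx; have -> : A - A *m K *m A = adjmx (1%:M - B) *m A *m (1%:M - B)
     + adjmx B *m (T - A) *m B.
  rewrite adjmxB adjmx1 !(mulmxBl, mulmxBr, mul1mx, mulmx1) BTB AB.
  move: (adjmx B *m A *m B) => Y; rewrite BA.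
  move: (A *m K *m A) => X; clear.
  by apply/matrixP=> i j; rewrite !mxE; move: (A i j) (X i j) (Y i j); clear=> *; ring.
exact: psdmxD (psdmx_conj _ pA) (psdmx_conj _ AT).
Qed.

Lemma rtr_schur n (mu : R) (A T K : 'M[C]_n) : 0 < mu -> psdmx A ->
  lemx A (mu%:C *: T) -> adjmx K = K -> K *m T = 1%:M ->
  rtr (A *m K *m A) <= mu * rtr A.
Proof.
move=> m0 pA AT hK KT.
have := @psdmx_schur n A (mu%:C *: T) (mu^-1%:C *: K) pA AT.
rewrite adjmxZR hK -scalemxAl -scalemxAr scalerA -rmorphM mulVf ?gt_eqF // scale1r.
move/(_ erefl KT); rewrite /lemx -scalemxAr -scalemxAl => /rtr_ge0.
by rewrite rtrB rtrZ subr_ge0 mulrC ler_pdivrMr // mulrC.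
Qed.

(* AM-GM, from 0 <= tr (c V^* - K X)^* T (c V^* - K X) with K = T^-1. *)
Lemma rtr_contraction_weighted n (c : R) (V X T K : 'M[C]_n) : 0 < c ->
  contraction V -> psdmx T -> adjmx K = K -> K *m T = 1%:M ->
  rtr (V *m X) <= 2^-1 * (c * rtr T + c^-1 * rtr (adjmx X *m K *m X)).
Proof.
move=> c0 cV pT hK KT; have TK : T *m K = 1%:M by exact: mulmx1C.
have := rtr_ge0 (psdmx_conj (c%:C *: adjmx V - K *m X) pT).
rewrite adjmxB adjmxZR adjmxK adjmxM hK.
have -> : (c%:C *: V - adjmx X *m K) *m T *m (c%:C *: adjmx V - K *m X)
   = c%:C *: (c%:C *: (V *m T *m adjmx V)) - c%:C *: (V *m X)
     - c%:C *: (adjmx (V *m X)) + adjmx X *m K *m X.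
  rewrite adjmxM mulmxBl -!scalemxAl -[adjmx X *m K *m T]mulmxA KT mulmx1.
  rewrite mulmxBl !mulmxBr -!scalemxAl -!scalemxAr !mulmxA.
  rewrite -[V *m T *m K]mulmxA TK mulmx1.
  by rewrite opprD opprK addrA.
rewrite rtrD !rtrB !rtrZ rtr_adj.
(* tr (V T V') = tr (V' V T), and V' V <= 1. *)
have TV : rtr (V *m T *m adjmx V) <= rtr T.
  have := rtr_mul_ge0 (contraction_adj cV) pT.
  rewrite adjmxK mulmxBl mul1mx rtrB subr_ge0 => h.
  by rewrite -mulmxA rtrC -mulmxA rtrC.
move: TV; move: (rtr _) (rtr (V *m X)) (rtr T) (rtr (adjmx X *m _ *m _)); clear -c0.
move=> x y z w xz h.
have h1 : 2 * c * y <= c * c * z + w.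
  have : c * c * x <= c * c * z by rewrite ler_pM2l // mulr_gt0.
  lra.
have -> : 2^-1 * (c * z + c^-1 * w) = (c * c * z + w) / (2 * c).
  by field; rewrite gt_eqF.
by rewrite ler_pdivlMr ?mulr_gt0 // mulrC.
Qed.

End Blocks.

(** * Independent uniform fourth roots of unity and their orthogonality relations *)

Section RandomPhases.
Variable R : realType.
Local Notation C := R[i].
Variable I : finType.
Local Notation T := {ffun I -> 'I_4}.

(** Random signs would not do: conj(s_k) s_l and conj(s_l) s_k would coincide. For fourth roots of
    unity the mean of s^2 vanishes. *)
Definition phase (t : T) (x : I) : C := ('i%R : C) ^+ t x.

(** Multiplies the phase at x by i; the addition in ['I_4] wraps around, consistently with i^4 =
    1. *)
Definition shift_phase (x : I) (t : T) : T :=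
  [ffun y => if y == x then t y + 1 else t y].

Lemma shift_phase_inj x : injective (shift_phase x).
Proof.
move=> t u /ffunP tu; apply/ffunP=> y; have := tu y; rewrite !ffunE.
by case: ifP => // _ /addIr.
Qed.

Lemma phase_shift x t y :
  phase (shift_phase x t) y = (if y == x then 'i%R else 1) * phase t y.
Proof.
rewrite /phase ffunE; case: ifP => _; last by rewrite mul1r.
have i4 : 'i%R ^+ 4 = 1 :> C by rewrite (exprM _ 2 2) sqrCi sqrrN expr1n.
by rewrite -exprS -(expr_mod (t y).+1 i4) /= -[in RHS]addn1.
Qed.

Lemma conj_phaseM t x : Num.conj (phase t x) * phase t x = 1.
Proof.
rewrite /phase rmorphXn /= -exprMn conjCi mulNr -expr2 sqrCi opprK.
exact: expr1n.
Qed.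

(** The shift permutes the sample space, so the sum equals w times itself. *)
Lemma sum_phase_eq0 (x : I) (w : C) (F : T -> C) : w != 1 ->
  (forall t, F (shift_phase x t) = w * F t) -> \sum_t F t = 0.
Proof.
move=> w1 wF.
have : \sum_t F t = w * \sum_t F t.
  rewrite mulr_sumr (reindex_inj (@shift_phase_inj x)) /=.
  by apply: eq_bigr=> t _; rewrite wF.
move/eqP; rewrite -subr_eq0 -{1}[\sum_t _]mul1r -mulrBl mulf_eq0 subr_eq0.
by rewrite eq_sym (negPf w1) => /eqP.
Qed.

Lemma Ci_neq1 : 'i%R != 1 :> C.
Proof.
apply/eqP=> /(congr1 (fun z => z ^+ 2)); rewrite sqrCi expr1n => /eqP.
by rewrite -subr_eq0 -opprD oppr_eq0 (_ : 1 + 1 = 2%:R) // pnatr_eq0.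
Qed.

Lemma conjCi_neq1 : Num.conj 'i%R != 1 :> C.
Proof.
rewrite -(rmorph1 Num.conj) (inj_eq (can_inj (@conjCK _))); exact: Ci_neq1.
Qed.

Definition phase_pair (p : I * I) (t : T) : C :=
  Num.conj (phase t p.1) * phase t p.2.

Lemma sum_phase_pair (p : I * I) : p.1 != p.2 -> \sum_t phase_pair p t = 0.
Proof.
move=> p12; apply: (@sum_phase_eq0 p.1 (Num.conj 'i%R)); first exact: conjCi_neq1.
move=> t; rewrite /phase_pair !phase_shift eqxx [p.2 == _]eq_sym (negPf p12).
by rewrite mul1r rmorphM mulrA.
Qed.

(** If the first indices differ, shifting the phase at x multiplies the summand by i, or by -1 when
    y' = x. If only the second differ, shifting at y multiplies it by conj(i). *)
Lemma sum_phase_pair_orth (p q : I * I) : p.1 != p.2 -> q.1 != q.2 ->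
  \sum_t Num.conj (phase_pair p t) * phase_pair q t
  = if p == q then #|{: T}|%:R else 0.
Proof.
case: p q => [x y] [x' y'] /= xy xy'.
have pairM z t : Num.conj (phase_pair (x, y) (shift_phase z t))
      * phase_pair (x', y') (shift_phase z t)
    = (if x == z then 'i%R else 1) * (if y == z then Num.conj 'i%R else 1)
      * ((if x' == z then Num.conj 'i%R else 1) * (if y' == z then 'i%R else 1))
      * (Num.conj (phase_pair (x, y) t) * phase_pair (x', y') t).
  rewrite /phase_pair /= !phase_shift !rmorphM /= !conjCK !(fun_if Num.conj) /=.
  by rewrite rmorph1; ring.
rewrite xpair_eqE; have [xx'|xx'] /= := eqVneq x x'; last first.
  apply: (@sum_phase_eq0 x (if y' == x then -1 else 'i%R)).
    case: ifP => _; last exact: Ci_neq1.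
    by rewrite -subr_eq0 -opprD oppr_eq0 (_ : 1 + 1 = 2%:R) // pnatr_eq0.
  move=> t; rewrite pairM eqxx [y == x]eq_sym (negPf xy) [x' == x]eq_sym (negPf xx').
  by case: ifP => _; rewrite ?mulr1 ?mul1r // -expr2 sqrCi.
subst x'; have [yy'|yy'] := eqVneq y y'; last first.
  apply: (@sum_phase_eq0 y (Num.conj 'i%R)); first exact: conjCi_neq1.
  by move=> t; rewrite pairM eqxx (negPf xy) [y' == y]eq_sym (negPf yy') !mulr1 !mul1r.
subst y'; rewrite -sumr_const; apply: eq_bigr => t _.
rewrite /phase_pair /= rmorphM /= conjCK mulrACA conj_phaseM mulr1 mulrC.
exact: conj_phaseM.
Qed.

(** Parseval's identity with matrix coefficients: orthogonality of the phase products removes all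
    cross terms. *)
Lemma sum_rtr_quadratic n (J : finType) (P : {pred J}) (e : J -> I * I)
    (B : J -> 'M[C]_n) (K : 'M[C]_n) :
  {in P &, injective e} -> {in P, forall j, (e j).1 != (e j).2} ->
  let X t := \sum_(j | P j) phase_pair (e j) t *: B j in
  \sum_t rtr (adjmx (X t) *m K *m X t)
  = #|{: T}|%:R * \sum_(j | P j) rtr (adjmx (B j) *m K *m B j).
Proof.
move=> inj_e ne_e X.
suff E : \sum_t adjmx (X t) *m K *m X t
     = #|{: T}|%:R *: \sum_(j | P j) adjmx (B j) *m K *m B j.
  rewrite -rtr_sum E -(rmorph_nat (real_complex R)) rtrZ; congr (_ * _).
  by apply: (big_morph (@rtr R n) (@rtrD R n)); rewrite /rtr mxtrace0.
have XE t : adjmx (X t) *m K *m X t = \sum_(j | P j) \sum_(k | P k)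
    (Num.conj (phase_pair (e j) t) * phase_pair (e k) t) *: (adjmx (B j) *m K *m B k).
  rewrite /X mulmx_sumr exchange_big /=; apply: eq_bigr=> k _.
  rewrite (big_morph (@adjmx R n n) (@adjmxD R n n) (id1 := 0)); last first.
    by apply/matrixP=> i j; rewrite !mxE rmorph0.
  rewrite !mulmx_suml; apply: eq_bigr=> j _.
  by rewrite adjmxZ -!scalemxAl -scalemxAr scalerA mulrC.
under eq_bigr do rewrite XE.
rewrite exchange_big scaler_sumr /=; apply: eq_bigr=> j Pj.
rewrite exchange_big (bigD1 j) //= [X in _ + X]big1 ?addr0.
  by rewrite -scaler_suml sum_phase_pair_orth ?eqxx // ne_e.
move=> k /andP[Pk kj]; rewrite -scaler_suml sum_phase_pair_orth ?ne_e //.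
case: eqP => [/inj_e jk|_]; last exact: scale0r.
by rewrite jk ?eqxx in kj.
Qed.

End RandomPhases.

(** * Random sampling of compressions and its first and second moments *)

Section SoftCovering.
Variable R : realType.
Local Notation C := R[i].

Section Sampling.
Variables (b a m : nat).
Hypothesis m_gt0 : (0 < m)%N.
Local Notation T := {ffun 'I_m * 'I_a -> 'I_4}.
Implicit Types (t : T) (Z : 'M[C]_(b * a)).

(** The index r runs over m independent random vectors. At Z = Phi this is the code before
    normalization. *)
Definition sample t Z : 'M[C]_b :=
  m%:R^-1%:C *: \sum_(r < m) compress (fun k => phase R t (r, k)) Z.

(** The off-diagonal terms only, without the factor 1/m; the index j reads ((r, k), l). *)
Definition fluctuation t Z : 'M[C]_b :=
  \sum_(j : 'I_m * 'I_a * 'I_a | j.1.2 != j.2)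
    phase_pair R ((j.1.1, j.1.2), (j.1.1, j.2)) t *: mxblk Z j.1.2 j.2.

Lemma mC_neq0 : m%:R != 0 :> C.
Proof. by rewrite pnatr_eq0 -lt0n. Qed.

(** The diagonal terms carry |s_k|^2 = 1 and so give the partial trace exactly, for every t. *)
Lemma sampleE t Z :
  sample t Z = ptrace2 Z + m%:R^-1%:C *: fluctuation t Z.
Proof.
have -> : fluctuation t Z = \sum_(r < m) \sum_k \sum_(l | k != l)
    phase_pair R ((r, k), (r, l)) t *: mxblk Z k l.
  rewrite pair_big /= pair_big_dep /=; exact: eq_bigr.
have -> : ptrace2 Z = m%:R^-1%:C *: \sum_(r < m) ptrace2 Z.
  rewrite sumr_const card_ord -scaler_nat scalerA fmorphV rmorph_nat.
  by rewrite mulVf ?mC_neq0 // scale1r.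
rewrite -scalerDr -big_split /=; congr (_ *: _); apply: eq_bigr=> r _.
rewrite compressE ptrace2_blk -big_split /=; apply: eq_bigr=> k _.
rewrite (bigD1 k) //= conj_phaseM scale1r; congr (_ + _).
by apply: eq_bigl=> l; rewrite eq_sym.
Qed.

Lemma sample_psd t Z : psdmx Z -> psdmx (sample t Z).
Proof.
move=> pZ; apply: psdmxZ; first by rewrite invr_ge0 ler0n.
by apply: psdmx_sum => r; exact: compress_psd.
Qed.

Lemma sample_adj t Z : adjmx (sample t Z) = sample t (adjmx Z).
Proof.
rewrite /sample adjmxZR adjmx_sum; congr (_ *: _).
by apply: eq_bigr=> r _; rewrite compress_adj.
Qed.

Lemma sampleB t Y Z : sample t (Y - Z) = sample t Y - sample t Z.
Proof.
rewrite /sample -scalerBr -sumrB; congr (_ *: _).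
by apply: eq_bigr=> r _; rewrite compressB.
Qed.

Lemma sampleN t Z : sample t (- Z) = - sample t Z.
Proof.
rewrite /sample -scalerN -sumrN; congr (_ *: _).
by apply: eq_bigr=> r _; rewrite /compress mulmxN mulNmx.
Qed.

Lemma sum_fluctuation Z : \sum_t fluctuation t Z = 0.
Proof.
rewrite exchange_big big1 //= => [[[r k] l]] /= kl.
rewrite -scaler_suml sum_phase_pair ?scale0r //=.
by rewrite xpair_eqE eqxx.
Qed.

Lemma sum_rtr_sample Z : \sum_t rtr (sample t Z) = #|{: T}|%:R * rtr Z.
Proof.
under eq_bigr do rewrite sampleE rtrD rtrZ rtr_ptrace2.
rewrite big_split /= sumr_const -mulr_sumr -rtr_sum sum_fluctuation.
by rewrite /rtr mxtrace0 mulr0 addr0 mulr_natl.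
Qed.

(** Distinct ((r, k), l) give distinct phase products, so Parseval applies; each r contributes the
    same off-diagonal blocks of Z. *)
Lemma sum_rtr_fluctuation Z (K : 'M[C]_b) : psdmx K ->
  \sum_t rtr (adjmx (fluctuation t Z) *m K *m fluctuation t Z)
  <= #|{: T}|%:R * (m%:R * rtr (adjmx Z *m tensmx K 1%:M *m Z)).
Proof.
move=> pK; rewrite /fluctuation sum_rtr_quadratic; last 2 first.
- by move=> [[r k] l] [[r' k'] l'] _ _ [] -> -> _ ->.
- by move=> [[r k] l]; rewrite unfold_in /= xpair_eqE eqxx.
apply: ler_wpM2l; first exact: ler0n.
have pos (B : 'M[C]_b) : 0 <= rtr (adjmx B *m K *m B).
  exact: rtr_ge0 (psdmx_conj _ pK).
rewrite rtr_tens_sandwich mulr_natl -[X in _ *+ X]card_ord -sumr_const.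
rewrite pair_big /= pair_big /=.
(* Restoring the diagonal blocks only increases the sum. *)
rewrite [leRHS](bigID (fun j : 'I_m * 'I_a * 'I_a => j.1.2 != j.2)) /=.
by rewrite lerDl sumr_ge0.
Qed.

End Sampling.

(** The probabilistic method: if every value exceeded K, so would the mean. *)
Lemma exists_le_mean (T : finType) (g : T -> R) (K : R) :
  (0 < #|T|)%N -> \sum_t g t <= #|T|%:R * K -> exists t, g t <= K.
Proof.
move=> T0 gK; apply: contrapT => /forallNP h.
suff : #|T|%:R * K < \sum_t g t by rewrite ltNge gK.
rewrite mulr_natl -sumr_const; case/card_gt0P: T0 => t0 _.
apply: ltr_sum => [|t _]; last by rewrite ltNge; apply/negP/h.
by apply/hasP; exists t0; rewrite ?mem_index_enum.
Qed.

(** One t serves all V, because the averaged quantity [g] bounds the left-hand side for every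
    contraction without depending on it. *)
Lemma soft_covering b a m (omega Z D : 'M[C]_(b * a)) (tau : 'M[C]_b) (mu c : R) :
  (0 < m)%N -> (0 < b)%N -> 0 < mu -> 0 < c ->
  adjmx omega = omega -> psdmx Z -> rtr Z <= 1 ->
  lemx (Z - omega) D -> lemx (- (Z - omega)) D ->
  subdensity tau -> lemx Z (mu%:C *: tensmx tau (1%:M : 'M[C]_a)) ->
  exists t : {ffun 'I_m * 'I_a -> 'I_4}, forall V, contraction V ->
    rtr (V *m (ptrace2 omega - sample t omega))
      <= 2 * rtr D + c + mu / (2 * c * m%:R).
Proof.
move=> m0 b0 mu0 c0 hO pZ tZ D1 D2 [pt tt] Ztau.
(* The shift q = 1/b makes tau + q invertible and adds trace 1, so that tr T <= 2. *)
have [q [qE q0]] : exists q : R, q = b%:R^-1 /\ 0 < q.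
  by exists (b%:R^-1); rewrite invr_gt0 ltr0n.
have [K pK KT] := psdmx_inv_shift pt q0.
have [T TE] : exists T, T = tau + q%:C%:M by eexists.
rewrite -TE in KT.
have pq : psdmx (q%:C%:M : 'M[C]_b).
  by rewrite -scalemx1; exact: psdmxZ (ltW q0) (psdmx1 _ _).
have pT : psdmx T by rewrite TE; exact: psdmxD pt pq.
have tT : rtr T <= 2.
  rewrite TE rtrD -[X in _ + X <= _]/(complex.Re (\tr (q%:C%:M))).
  rewrite mxtrace_scalar -(rmorphMn (real_complex R)) /= qE -mulr_natl.
  rewrite divff ?pnatr_eq0 -?lt0n //.
  have : rtr tau <= 1 by move: tt; rewrite lecE /= => /andP[].
  by move: (rtr tau); clear => x; lra.
have ZT : lemx Z (mu%:C *: tensmx T (1%:M : 'M[C]_a)).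
  rewrite /lemx; have -> : mu%:C *: tensmx T (1%:M : 'M[C]_a) - Z
      = (mu%:C *: tensmx tau 1%:M - Z) + mu%:C *: tensmx q%:C%:M 1%:M.
    rewrite addrAC -scalerDr; congr (_ *: _ - _).
    by rewrite TE; apply: mxblkP=> k l; apply/matrixP=> i j;
      rewrite !(mxE, tensmxE) mulrDl.
  apply: psdmxD Ztau (psdmxZ (ltW mu0) _).
  have -> : tensmx (q%:C%:M : 'M[C]_b) (1%:M : 'M[C]_a) = q%:C *: 1%:M.
    by rewrite -tensmx11 -[q%:C%:M]scalemx1; apply/matrixP=> x y; rewrite !mxE mulrA.
  exact: psdmxZ (ltW q0) (psdmx1 _ _).
have quad : rtr (adjmx Z *m tensmx K 1%:M *m Z) <= mu.
  have := @rtr_schur R _ mu Z (tensmx T 1%:M) (tensmx K 1%:M) mu0 pZ ZT.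
  rewrite adjmx_tens1 pK.1 tensmx_mul KT mul1mx tensmx11 => /(_ erefl erefl).
  rewrite pZ.1 => h; apply: (le_trans h); rewrite -[leRHS]mulr1.
  by rewrite ler_pM2l.
have m1 : 0 < m%:R :> R by rewrite ltr0n.
have [W WE] : exists W, W = Z - omega by eexists.
rewrite -WE in D1 D2.
have hW : adjmx W = W by rewrite WE adjmxB hO pZ.1.
pose g (t : {ffun 'I_m * 'I_a -> 'I_4}) := rtr D + rtr (sample t D)
  + (c + (2 * c * m%:R ^+ 2)^-1
       * rtr (adjmx (fluctuation t Z) *m K *m fluctuation t Z)).
have [||t gt] := @exists_le_mean _ g (2 * rtr D + c + mu / (2 * c * m%:R)).
- by apply/card_gt0P; exists [ffun=> 0].
(* In the mean, tr D occurs twice, once directly and once through [sample]; the last term averages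
   to at most m mu / (2 c m^2). *)
- have cst (x : R) : \sum_(t : {ffun 'I_m * 'I_a -> 'I_4}) x
      = #|{: {ffun 'I_m * 'I_a -> 'I_4}}|%:R * x by rewrite sumr_const mulr_natl.
  rewrite /g !big_split /= sum_rtr_sample // -mulr_sumr !cst.
  have := @sum_rtr_fluctuation b a m Z K pK.
  have : 0 <= #|{: {ffun 'I_m * 'I_a -> 'I_4}}|%:R :> R by exact: ler0n.
  move: (\sum_t _) (#|_|%:R) => S n n0 SE.
  have cm : 0 < 2 * c * m%:R ^+ 2 by rewrite !mulr_gt0 ?exprn_gt0.
  have : (2 * c * m%:R ^+ 2)^-1 * S <= n * (mu / (2 * c * m%:R)).
    rewrite ler_pdivrMl //; apply: (le_trans SE).
    have -> : 2 * c * m%:R ^+ 2 * (n * (mu / (2 * c * m%:R))) = n * (m%:R * mu).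
      by field; rewrite !gt_eqF.
    by apply: ler_wpM2l => //; apply: ler_wpM2l => //; exact: ltW.
  move: (rtr D) (_ * S) (mu / _); clear=> x y z; lra.
exists t => V cV; apply: le_trans gt; rewrite /g.
(* Passing from omega to Z costs W twice, in the partial trace and in the sample; each is controlled
   by D, and the fluctuation of Z by the weight T. *)
have -> : ptrace2 omega - sample t omega
   = - ptrace2 W + sample t W - m%:R^-1%:C *: fluctuation t Z.
  rewrite -[m%:R^-1%:C *: _](addKr (ptrace2 Z)) -sampleE // WE ptrace2B sampleB.
  move: (ptrace2 _) (ptrace2 _) (sample _ _) (sample _ _); clear => A1 A2 A3 A4.
  by apply/matrixP=> i j; rewrite !mxE; ring.
rewrite mulmxBr mulmxDr mulmxN rtrB rtrD -mulNmx.
rewrite -[- rtr (V *m (_ *: _))]rtrN -mulNmx.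
apply: lerD; first apply: lerD.
- rewrite -[leRHS]rtr_ptrace2; apply: rtr_contraction_le.
  + exact: contractionN.
  + by rewrite -ptrace2_adj hW.
  + by rewrite /lemx -ptrace2B; exact: ptrace2_psd D1.
  + by rewrite /lemx -ptrace2N -ptrace2B; exact: ptrace2_psd D2.
- apply: rtr_contraction_le; first exact: cV.
  + by rewrite sample_adj hW.
  + by rewrite /lemx -sampleB; exact: sample_psd D1.
  + by rewrite /lemx -sampleN -sampleB; exact: sample_psd D2.
have := rtr_contraction_weighted (m%:R^-1%:C *: fluctuation t Z)
  c0 (contractionN cV) pT pK.1 KT.
move/le_trans; apply; rewrite adjmxZR -!scalemxAl -scalemxAr !rtrZ.
move: (rtr (adjmx _ *m _ *m _)) => y; move: (rtr T) tT => x x2.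
have -> : 2^-1 * (c * x + c^-1 * (m%:R^-1 * (m%:R^-1 * y)))
   = c * (x / 2) + (2 * c * m%:R ^+ 2)^-1 * y by field; rewrite !gt_eqF.
rewrite lerD2r -[leRHS]mulr1 ler_pM2l //; move: x2; clear; lra.
Qed.

End SoftCovering.

(** * Support projectors and the operator inequality for purifications *)

Section OperatorInequality.
Variable R : realType.
Local Notation C := R[i].

Lemma psdmx_tens1 b a (X : 'M[C]_b) :
  psdmx X -> psdmx (tensmx X (1%:M : 'M[C]_a)).
Proof.
move=> /sqrtmxP [[hq _] <-]; rewrite -[1%:M]mulmx1 -tensmx_mul -{1}hq.
by rewrite -adjmx_tens1; exact: psdmx_gram.
Qed.

(** Complete positivity is used with a one-dimensional ancilla. *)
Lemma completely_positive_psd a b (N : {linear 'M[C]_a -> 'M[C]_b}) X :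
  completely_positive N -> psdmx X -> psdmx (N X).
Proof.
move=> cpN pX; have -> : X = mxblk (tensmx X (1%:M : 'M[C]_1)) ord0 ord0.
  by rewrite mxblk_tens1 scale1r.
rewrite -tensmap_blk -compress_delta; apply: compress_psd; apply: cpN.
exact: psdmx_tens1.
Qed.

(** Factor E = A B through its rank; idempotence forces B A = 1, whose trace is the rank. *)
Lemma mxtrace_idempotent n (E : 'M[C]_n) : E *m E = E -> \tr E = (\rank E)%:R.
Proof.
move=> EE; move: (mulmx_base E) (row_base_free E) (col_base_full E).
move: (row_base E) (col_base E) => B A AB freeB fullA.
have E1 : B *m A = 1%:M.
  apply: (row_free_inj freeB); apply: (row_full_inj fullA).
  by rewrite mul1mx !mulmxA AB -mulmxA AB.
by rewrite -{1}AB mxtrace_mulC E1 mxtrace1.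
Qed.

Lemma gram_eq0 m n (Y : 'M[C]_(m, n)) : adjmx Y *m Y = 0 -> Y = 0.
Proof.
move=> /matrixP Y0; apply/matrixP=> i j; have := Y0 j j; rewrite !mxE => /eqP.
rewrite psumr_eq0 => [/allP /(_ i (mem_index_enum _))|k _]; last first.
  by rewrite adjmxE mulrC mul_conjC_ge0.
by rewrite adjmxE mulf_eq0 conjC_eq0 orbb => /eqP.
Qed.

(** Q = M' G M, with M' the adjoint of M and G the pseudo-inverse of S = M M'. Its trace is that of
    the idempotent G S, whose rank is at most that of S. *)
Lemma support_projector m n (M : 'M[C]_(m, n)) :
  exists Q, [/\ adjmx Q = Q, Q *m Q = Q, Q *m adjmx M = adjmx M
    & \tr Q <= (\rank (M *m adjmx M))%:R].
Proof.
have [S SE] : exists S, S = M *m adjmx M by eexists.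
have pS : psdmx S by rewrite SE -{1}[M]adjmxK; exact: psdmx_gram.
have [tE _ PaP aPP d0] := psdmx_spectral pS.
move: (spectralmx S) (spectral_diag S) tE PaP aPP d0 => P d tE PaP aPP d0.
pose fc (u : 'rV[C]_m) := adjmx P *m diag_mx u *m P.
have fcM u v : fc u *m fc v = fc (\row_i (u 0 i * v 0 i)).
  exact: conj_diag_mxM.
have [G GE] : exists G, G = fc (\row_i (d 0 i)^-1) by eexists.
have GSG : G *m S *m G = G.
  rewrite tE -/(fc d) GE !fcM; congr fc; apply/rowP=> i; rewrite !mxE.
  by have [->|h] := eqVneq (d 0 i) 0; rewrite ?invr0 ?mul0r // mulVf // mul1r.
have SGS : S *m G *m S = S.
  rewrite tE -/(fc d) GE !fcM; congr fc; apply/rowP=> i; rewrite !mxE.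
  by have [->|h] := eqVneq (d 0 i) 0; rewrite ?mulr0 // mulfV // mul1r.
have pG : psdmx G.
  by rewrite GE; apply/psdmx_conj/psdmx_diag_mx=> i; rewrite mxE invr_ge0.
exists (adjmx M *m G *m M); rewrite -SE; split.
- by rewrite !adjmxM adjmxK pG.1 mulmxA.
- rewrite !mulmxA -[_ *m M *m adjmx M]mulmxA -SE -[in RHS]GSG !mulmxA.
  by [].
(* The difference has zero Gram matrix, by S G S = S. *)
- rewrite -mulmxA -SE; apply/eqP; rewrite -subr_eq0; apply/eqP/gram_eq0.
  rewrite adjmxB !adjmxM adjmxK pG.1 pS.1 mulmxBl !mulmxBr -!mulmxA.
  have MM Y : M *m (adjmx M *m Y) = S *m Y by rewrite SE mulmxA.
  by rewrite !MM -SE !mulmxA !SGS !subrr.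
rewrite -mulmxA mxtrace_mulC -mulmxA -SE mxtrace_idempotent.
  by rewrite ler_nat mxrankM_maxr.
by rewrite mulmxA GSG.
Qed.

(** Reshape phi and x into matrices M and X and put W = M' X, M' the adjoint. Then <phi|x> = tr W
    and <x|sigma (x) 1|x> = tr (W' W), so the claim is |tr W|^2 <= r tr (W' W): Cauchy-Schwarz for W
    = Q W with tr Q <= r. *)
Lemma purification_le a (sigma : 'M[C]_a) (Phi : 'M[C]_(a * a)) (r : nat) :
  purification sigma Phi -> (0 < r)%N -> (\rank sigma <= r)%N ->
  lemx Phi ((r%:R : R)%:C *: tensmx sigma 1%:M).
Proof.
move=> [[phi ->] sE] r0 rk; pose M := \matrix_(i, k) phi (mxtens_index (i, k)) 0.
have sM : sigma = M *m adjmx M.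
  rewrite -sE; apply/matrixP=> i j; rewrite !mxE; apply: eq_bigr=> k _.
  by rewrite !mxE big_ord1 !mxE.
have [Q [hQ QQ QM trQ]] := support_projector M.
have {}trQ : \tr Q <= r%:R by rewrite (le_trans trQ) // -sM ler_nat.
have ps : psdmx sigma by rewrite sM -{1}[M]adjmxK; exact: psdmx_gram.
split.
  rewrite adjmxB adjmxZR adjmx_tens1 ps.1; congr (_ - _).
  by rewrite adjmxM adjmxK.
move=> x; pose X := \matrix_(i, k) x (mxtens_index (i, k)) 0.
have [W WE] : exists W, W = adjmx M *m X by eexists.
have QW : Q *m W = W by rewrite WE mulmxA QM.
have wE : (adjmx phi *m x) 0 0 = \tr W.
  rewrite WE mxE big_mxtens exchange_big; apply: eq_bigr=> k _ /=.
  by rewrite mxE; apply: eq_bigr=> i _; rewrite !mxE.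
have wE' : (adjmx x *m phi) 0 0 = Num.conj (\tr W).
  by rewrite -wE -[in RHS]adjmxE adjmxM adjmxK.
have qE : (adjmx x *m tensmx sigma 1%:M *m x) 0 0 = \tr (adjmx W *m W).
  have -> : adjmx W *m W = adjmx X *m sigma *m X.
    by rewrite WE adjmxM adjmxK sM !mulmxA.
  rewrite mxE big_mxtens exchange_big; apply: eq_bigr=> k _ /=.
  rewrite mxE; apply: eq_bigr=> j _; rewrite [X j k]mxE; congr (_ * _).
  rewrite mxE big_mxtens mxE; apply: eq_bigr=> i _.
  rewrite (bigD1 k) //= [X in _ + X]big1 ?addr0; last first.
    by move=> l lk; rewrite tensmxE [1%:M l k]mxE (negPf lk) !mulr0.
  by rewrite tensmxE [1%:M k k]mxE eqxx mulr1 !mxE.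
rewrite mulmxBr mulmxBl mxE -scalemxAr -scalemxAl [X in X + _]mxE qE rmorph_nat.
have -> : (- (adjmx x *m (phi *m adjmx phi) *m x)) 0 0 = - (Num.conj (\tr W) * \tr W).
  by rewrite mxE !mulmxA -[_ *m adjmx phi *m x]mulmxA mxE big_ord1 wE wE'.
have rC : 0 < r%:R :> C by rewrite ltr0n.
(* Multiplied by r, the claim follows from the nonnegative square norm of r W - (tr W) Q together
   with tr Q <= r. *)
rewrite -(pmulr_rge0 _ rC).
have := psdmx_mxtrace_ge0 (psdmx_gram (r%:R *: W - \tr W *: Q)).
rewrite adjmxB !adjmxZ hQ rmorph_nat mulmxBl !mulmxBr -!scalemxAl -!scalemxAr QQ QW.
have aQ : \tr (adjmx W *m Q) = Num.conj (\tr W).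
  by rewrite -mxtrace_adj -{2}QW adjmxM hQ.
rewrite !raddfB /= !mxtraceZ aQ => h; apply: (le_trans h).
have := ler_wpM2l (mul_conjC_ge0 (\tr W)) trQ.
move: (\tr (_ *m W)) (\tr W) (Num.conj _) (\tr Q) (r%:R : C); clear=> t w w' q z.
rewrite -subr_ge0 => wq; rewrite -subr_ge0.
by apply: le_trans wq _; rewrite le_eqVlt; apply/orP; left; apply/eqP; ring.
Qed.

End OperatorInequality.

(** * Normalization, rank and size of codes, and the two halves of the theorem *)

Section Codes.
Variable R : realType.
Local Notation C := R[i].

(** Any state is a code of error 1, which settles the case 8 (delta + eta) >= 1. *)
Lemma trnorm_code_le1 b (rho S : 'M[C]_b) : psdmx rho -> psdmx S ->
  rtr rho = 1 -> rtr S = 1 -> 2^-1 * trnorm (rho - S) <= 1.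
Proof.
move=> pr pS tr tS; have [V cV ->] := trnorm_contraction (rho - S).
have := rtr_contraction_psd cV pr.
have := rtr_contraction_psd (contractionN cV) pS.
rewrite mulmxBr mulNmx rtrB rtrN tr tS.
by move: (rtr _) (rtr _); clear=> x y; lra.
Qed.

(** Testing with V = 1 and V = -1 gives |1 - tr S| <= K < 1. Dividing by the trace then costs at
    most another K, and the factor 1/2 of the code error absorbs it. *)
Lemma normalized_code a b (N : {linear 'M[C]_a -> 'M[C]_b}) (rho : 'M[C]_b)
    (S : 'M[C]_a) (K : R) :
  cptp N -> psdmx rho -> rtr rho = 1 -> psdmx S -> K < 1 ->
  (forall V, contraction V -> rtr (V *m (rho - N S)) <= K) ->
  exists S', [/\ density S', (\rank S' <= \rank S)%N
    & 2^-1 * trnorm (rho - N S') <= K].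
Proof.
move=> [cpN tpN] pr tr pS K1 HK.
have [x xE] : exists x, x = rtr S by eexists.
have pNS : psdmx (N S) by exact: completely_positive_psd.
have tN : rtr (N S) = x by rewrite /rtr tpN xE.
have := HK _ (@contraction1 R b); rewrite mul1mx rtrB tr tN => K2.
have := HK _ (contractionN (@contraction1 R b)).
rewrite mulNmx mul1mx rtrN rtrB tr tN => K3.
have x0 : 0 < x by move: K1 K2; clear; lra.
have xV : 0 <= x^-1 by rewrite invr_ge0 ltW.
exists (x^-1%:C *: S); split.
- split; first exact: psdmxZ.
  by rewrite mxtraceZ (psdmx_mxtrace pS) -xE -rmorphM mulVf ?gt_eqF.
- exact: mxrank_scale.
have [V cV ->] := trnorm_contraction (rho - N (x^-1%:C *: S)).
have h1 := HK _ cV.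
have h2 := rtr_contraction_psd cV pNS.
have h3 := rtr_contraction_psd (contractionN cV) pNS.
move: h1 h2 h3; rewrite linearZ !mulmxBr mulNmx !rtrB rtrN -scalemxAr rtrZ tN.
move: (rtr (V *m rho)) (rtr (V *m N S)) K2 K3; clear -x0=> u y K2 K3 h1 h2 h3.
have xx : x^-1 * x = 1 by rewrite mulVf ?gt_eqF.
have [x1|x1] := leP 1 x.
  have : (1 - x^-1) * y <= (1 - x^-1) * x.
    by apply: ler_wpM2l => //; rewrite subr_ge0 invf_le1.
  lra.
have : (x^-1 - 1) * (- y) <= (x^-1 - 1) * x.
  by apply: ler_wpM2l => //; rewrite subr_ge0 invf_ge1 // ltW.
lra.
Qed.

Lemma mxrank_sum_le m n (I : finType) (F : I -> 'M[C]_(m, n)) (r : nat) :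
  (forall i, \rank (F i) <= r)%N -> (\rank (\sum_i F i)%R <= #|I| * r)%N.
Proof.
move=> Fr; rewrite -sum_nat_const.
apply: (big_ind2 (fun (A : 'M[C]_(m, n)) k => \rank A <= k)%N) => [|A p B q Ap Bq|i _].
- by rewrite mxrank0.
- exact: leq_trans (mxrank_add _ _) (leq_add Ap Bq).
exact: Fr.
Qed.

Lemma mxrank_sample a m t (phi : 'cV[C]_(a * a)) :
  (\rank (sample (m := m) t (phi *m adjmx phi) : 'M[C]_a) <= m)%N.
Proof.
apply: leq_trans (mxrank_scale _ _) _.
apply: (@leq_trans (#|'I_m| * 1)%N); last by rewrite card_ord muln1.
apply: mxrank_sum_le => r; rewrite /compress mulmxA -mulmxA.
by apply: leq_trans (mxrankM_maxl _ _) (rank_leq_col _).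
Qed.

(** Sampling acts on the reference system and N on the other, so they commute: the channel sends the
    sampled Phi to the sampled omega. *)
Lemma sample_channel a b m t (N : {linear 'M[C]_a -> 'M[C]_b}) (Phi : 'M[C]_(a * a)) :
  N (sample (m := m) t Phi) = sample t (channel_output N Phi).
Proof.
rewrite /sample linearZ linear_sum; congr (_ *: _); apply: eq_bigr=> r _.
rewrite !compressE linear_sum; apply: eq_bigr=> k _.
by rewrite linear_sum; apply: eq_bigr=> l _; rewrite linearZ /= tensmap_blk.
Qed.

Lemma ptrace2_channel a b (N : {linear 'M[C]_a -> 'M[C]_b}) (Phi : 'M[C]_(a * a)) :
  ptrace2 (channel_output N Phi) = N (ptrace2 Phi).
Proof.
rewrite !ptrace2_blk linear_sum; apply: eq_bigr=> k _; exact: tensmap_blk.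
Qed.

(** A strict lower bound passes through the three nested suprema and yields witnesses, whether or
    not they are attained. *)
Lemma Hmin_smooth_gt b a (delta l : R) (omega : 'M[C]_(b * a)) :
  (l%:E < Hmin_smooth delta omega)%E ->
  exists Z tau l', [/\ pball delta omega Z, subdensity tau, l < l'
    & lemx Z ((2 `^ (- l'))%:C *: tensmx tau (1%:M : 'M[C]_a))].
Proof.
move=> /ereal_sup_gt [_ [Z bZ <-]] /ereal_sup_gt [_ [tau dtau <-]].
move=> /ereal_sup_gt [_ [l' Zl <-]]; rewrite lte_fin => ll'.
by exists Z, tau, l'.
Qed.

Lemma log2_pow (x : R) : 0 < x -> 2 `^ (log2 x) = x.
Proof.
move=> x0; rewrite /powR pnatr_eq0 /log2 divfK ?lnK ?posrE //.
by rewrite gt_eqF // ln_gt0 // ltr1n.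
Qed.

Lemma powR_2log2 (x : R) : 0 < x -> 2 `^ (2 * log2 x) = x ^+ 2.
Proof. by move=> x0; rewrite mulrC powRrM log2_pow // powR_mulrn ?ltW. Qed.

Lemma ln2_gt0 : 0 < ln 2 :> R.
Proof. by rewrite ln_gt0 // ltr1n. Qed.

Lemma ler_log2 (x y : R) : 0 < x -> x <= y -> log2 x <= log2 y.
Proof.
move=> x0 xy; rewrite /log2 ler_pM2r ?invr_gt0 ?ln2_gt0 //.
by rewrite ler_ln // posrE // (lt_le_trans x0).
Qed.

Lemma log2_powR (x : R) : log2 (2 `^ x) = x.
Proof. by rewrite /log2 ln_powR mulfK // gt_eqF // ln2_gt0. Qed.

Lemma log2_1 : log2 1 = 0 :> R.
Proof. by rewrite /log2 ln1 mul0r. Qed.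

(* The factor 4 pays for rounding the size down to an integer and for
   taking an almost optimal state in the supremum defining [Hmin_smooth]. *)
Lemma code_size b a (delta eta : R) (omega : 'M[C]_(b * a)) : 0 < eta ->
  Hmin_smooth delta omega != -oo%E ->
  exists m Z tau l, (0 < m)%N /\ [/\
    ((log2 m%:R)%:E <= pospart (- Hmin_smooth delta omega - (2 * log2 eta)%:E))%E,
    pball delta omega Z, subdensity tau,
    lemx Z ((2 `^ (- l))%:C *: tensmx tau (1%:M : 'M[C]_a))
    & 2 `^ (- l) <= 4 * eta ^+ 2 * m%:R].
Proof.
move=> eta0; case E : (Hmin_smooth delta omega) => [h| |] // _; last first.
  (* At +oo a single vector suffices: some l above - 2 log2 eta is available, so that 2^(-l) <=
     eta^2. *)
  have : ((- (2 * log2 eta))%:E < Hmin_smooth delta omega)%E by rewrite E ltry.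
  move=> /Hmin_smooth_gt [Z [tau [l [bZ dtau ll Zl]]]].
  exists 1%N, Z, tau, l; do 2?split => //.
    by rewrite log2_1 /pospart le_max lexx orbT.
  have : 2 `^ (- l) <= 2 `^ (2 * log2 eta) by apply: ler_powR; [rewrite ler1n | lra].
  rewrite powR_2log2 //.
  have : 0 <= eta ^+ 2 by rewrite sqr_ge0.
  by move: (2 `^ _) (eta ^+ 2); clear=> u v; lra.
(* Settling for l > h - 1 costs the first factor 2. *)
have : ((h - 1)%:E < Hmin_smooth delta omega)%E by rewrite E lte_fin; lra.
move=> /Hmin_smooth_gt [Z [tau [l [bZ dtau ll Zl]]]].
have [y yE] : exists y, y = 2 `^ (- h - 2 * log2 eta) by eexists.
have y0 : 0 < y by rewrite yE powR_gt0 // ltr0n.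
(* The maximum with 1 keeps m positive; y < m + 1 <= 2 m is the second factor 2. *)
pose M := Num.max 1 y; pose m := Num.truncn M.
have M1 : 1 <= M by rewrite le_max lexx.
have M0 : 0 <= M by rewrite (le_trans ler01).
have /andP[m_le m_gt] := truncn_itv M0; rewrite -/m in m_le m_gt.
have m0 : (0 < m)%N by rewrite truncn_gt0.
have m1 : 1 <= m%:R :> R by rewrite ler1n.
exists m, Z, tau, l; do 2?split => //.
- rewrite /pospart le_max -EFinN -EFinB !lee_fin.
  have mR : 0 < m%:R :> R by rewrite ltr0n.
  have [y1|y1] := leP 1 y; apply/orP; [left|right].
    rewrite -[leRHS]log2_powR -yE; apply: ler_log2 => //.
    by rewrite (le_trans m_le) // /M max_r.
  by rewrite -log2_1 ler_log2 // (le_trans m_le) // /M max_l // ltW.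
have hy : 2 `^ (- (h - 1)) = 2 * eta ^+ 2 * y.
  have t0 : 2 != 0 :> R by rewrite pnatr_eq0.
  rewrite opprB powRD ?t0 ?implybT // powRr1 ?ler0n // yE powRB ?t0 ?implybT //.
  rewrite powR_2log2 // -[RHS]mulrA [X in _ = 2 * X]mulrCA mulfV ?mulr1 //.
  by rewrite expf_neq0 // gt_eqF.
have : 2 `^ (- l) <= 2 `^ (- (h - 1)) by apply: ler_powR; [rewrite ler1n | lra].
rewrite hy => /le_trans; apply.
have -> : 4 * eta ^+ 2 * m%:R = 2 * eta ^+ 2 * (2 * m%:R) by ring.
apply: ler_wpM2l; first by rewrite mulr_ge0 // sqr_ge0.
have : y <= M by rewrite /M le_max lexx orbT.
move: m_gt; rewrite -natr1; move: m1; clear; lra.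
Qed.

Lemma trnorm0 n : trnorm (0 : 'M[C]_n) = 0.
Proof.
have [V _ ->] := trnorm_contraction (0 : 'M[C]_n).
by rewrite mulmx0 /rtr mxtrace0.
Qed.

Lemma delta_density a (i : 'I_a) : density (delta_mx i i : 'M[C]_a).
Proof.
split; last first.
  rewrite /mxtrace (bigD1 i) //= mxE eqxx big1 ?addr0 // => j ji.
  by rewrite mxE (negPf ji).
have -> : delta_mx i i = adjmx (delta_mx i i) *m delta_mx i i :> 'M[C]_a.
  by rewrite adjmx_delta mul_delta_mx.
exact: psdmx_gram.
Qed.

Lemma density_gt0 a (sigma : 'M[C]_a) : density sigma -> (0 < a)%N.
Proof.
case=> _; case: a sigma => // sigma; rewrite /mxtrace big_ord0 => /eqP.
by rewrite eq_sym oner_eq0.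
Qed.

Lemma density_rank_gt0 a (sigma : 'M[C]_a) : density sigma -> (0 < \rank sigma)%N.
Proof.
case=> _ t1; rewrite lt0n mxrank_eq0; apply/eqP=> s0; move/eqP: t1.
by rewrite s0 mxtrace0 eq_sym oner_eq0.
Qed.

Lemma density_rtr a (sigma : 'M[C]_a) : density sigma -> rtr sigma = 1.
Proof. by case=> _; rewrite /rtr => ->. Qed.

Lemma purification_psd a (sigma : 'M[C]_a) (Phi : 'M[C]_(a * a)) :
  purification sigma Phi -> psdmx Phi.
Proof. by case=> [[phi ->] _]; rewrite -{1}[phi]adjmxK; exact: psdmx_gram. Qed.

Lemma covering_achievability a b (N : {linear 'M[C]_a -> 'M[C]_b})
    (rho : 'M[C]_b) (sigma : 'M[C]_a) (Phi : 'M[C]_(a * a)) (delta eta : R) :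
  cptp N -> density rho -> preimage_states rho N sigma ->
  purification sigma Phi -> 0 < delta < 1 -> 0 < eta < 1 ->
  exists S : 'M[C]_a, [/\ density S,
    ((log2 (\rank S)%:R)%:E <=
      pospart (- Hmin_smooth delta (channel_output N Phi) - (2 * log2 eta)%:E))%E
    & 2^-1 * trnorm (rho - N S) <= 8 * (delta + eta)].
Proof.
move=> cN dr [ds Ns] pu d01 /andP[e0 e1]; have [cpN tpN] := cN.
have /andP[d0 d1] := d01.
have [omega oE] : exists omega, omega = channel_output N Phi by eexists.
have po : psdmx omega by rewrite oE; apply: cpN; exact: purification_psd pu.
have ptro : ptrace2 omega = rho by rewrite oE ptrace2_channel pu.2.
have to : rtr omega = 1 by rewrite -rtr_ptrace2 ptro density_rtr.
rewrite -oE.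
(* At -oo the size bound is +oo, and sigma itself is an exact code. *)
have [H|H] := eqVneq (Hmin_smooth delta omega) -oo%E.
  exists sigma; split => //.
    by rewrite H /pospart /= le_max leey.
  by rewrite Ns subrr trnorm0 mulr0 mulr_ge0 // addr_ge0 // ltW.
have [m [Z [tau [l [m0 [mH [[pZ tZ] bZ] dtau Zl le_mu]]]]]] := code_size e0 H.
have logm (S : 'M[C]_a) : density S -> (\rank S <= m)%N ->
    ((log2 (\rank S)%:R)%:E
      <= pospart (- Hmin_smooth delta omega - (2 * log2 eta)%:E))%E.
  move=> dS rS; apply: le_trans mH; rewrite lee_fin; apply: ler_log2.
    by rewrite ltr0n density_rank_gt0.
  by rewrite ler_nat.
(* A pure state has rank 1 and so meets any admissible size. *)
have [K1|K1] := leP 1 (8 * (delta + eta)).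
  have i0 : 'I_a by exact: Ordinal (density_gt0 ds).
  exists (delta_mx i0 i0); have di := delta_density i0; split=> //.
    by apply: logm => //; rewrite mxrank_delta.
  apply: le_trans K1; apply: trnorm_code_le1.
  - exact: dr.1.
  - exact: completely_positive_psd cpN di.1.
  - exact: density_rtr.
  - by rewrite /rtr tpN di.2.
have rZ : rtr Z <= 1 by move: tZ; rewrite lecE /= => /andP[].
have [D [D1 D2 tD]] := purified_distance_dominated d01 pZ po rZ to bZ.
have mu0 : 0 < 2 `^ (- l) by rewrite powR_gt0.
(* With c = eta the error is at most 8 delta + eta + 2 eta, the last term because mu <= 4 eta^2
   m. *)
have [t Ht] := soft_covering m0 (density_gt0 dr) mu0 e0 po.1 pZ rZ D1 D2 dtau Zl.
have [||S [dS rS eS]] := @normalized_code a b N rho (sample t Phi) (8 * (delta + eta))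
  cN dr.1 (density_rtr dr) _ K1.
- exact: sample_psd (purification_psd pu).
- move=> V cV; rewrite sample_channel -oE -ptro; apply: le_trans (Ht V cV) _.
  have : 2 `^ (- l) / (2 * eta * m%:R) <= 2 * eta.
    have mR : 0 < m%:R :> R by rewrite ltr0n.
    rewrite ler_pdivrMr ?mulr_gt0 //; apply: (le_trans le_mu).
    by rewrite le_eqVlt; apply/orP; left; apply/eqP; ring.
  move: (_ / _) (rtr D) tD; clear -e0=> x y; lra.
exists S; split=> //; apply: logm => //; apply: leq_trans rS _.
by case: pu => [[phi ->] _]; exact: mxrank_sample.
Qed.

(** N(sigma) and - log2 of the rank of sigma are admissible in the suprema of [Hmin]: apply N (x) id
    to the operator inequality for Phi. The positive part is harmless as the rank is at least 1. *)
Lemma covering_converse a b (N : {linear 'M[C]_a -> 'M[C]_b})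
    (sigma : 'M[C]_a) (Phi : 'M[C]_(a * a)) :
  cptp N -> density sigma -> purification sigma Phi ->
  (pospart (- Hmin (channel_output N Phi)) <= (log2 (\rank sigma)%:R)%:E)%E.
Proof.
move=> [cpN tpN] ds pu; have r0 := density_rank_gt0 ds.
have rR : 0 < (\rank sigma)%:R :> R by rewrite ltr0n.
rewrite /pospart ge_max; apply/andP; split; last first.
  by rewrite lee_fin -log2_1 ler_log2 // ler1n.
rewrite leeNl; have NsD : subdensity (N sigma).
  split; first exact: completely_positive_psd cpN ds.1.
  by rewrite tpN ds.2.
apply: le_trans (ereal_sup_ubound _); last by exists (N sigma); [exact: NsD|].
apply: ereal_sup_ubound; exists (- log2 (\rank sigma)%:R) => //=.
rewrite opprK log2_pow //.
have := cpN _ _ (purification_le pu r0 (leqnn _)).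
rewrite /lemx; congr psdmx; apply: mxblkP => k l.
rewrite tensmap_blk.
have blkB d (X Y : 'M[C]_(d * a)) : mxblk (X - Y) k l = mxblk X k l - mxblk Y k l.
  by apply/matrixP=> i j; rewrite !mxE.
have blkZ d c (X : 'M[C]_(d * a)) : mxblk (c *: X) k l = c *: mxblk X k l.
  by apply/matrixP=> i j; rewrite !mxE.
rewrite !blkB !blkZ !mxblk_tens1 linearB /channel_output tensmap_blk !linearZ /=.
by rewrite !scalerA mulrC.
Qed.

End Codes.

Theorem theorem14 (R : realType) (a b : nat)
    (N : {linear 'M[R[i]]_a -> 'M[R[i]]_b}) (hN : cptp N)
    (rho : 'M[R[i]]_b) (hrho : density rho) :
  (forall (sigma : 'M[R[i]]_a) (Phi : 'M[R[i]]_(a * a)),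
     preimage_states rho N sigma -> purification sigma Phi ->
     forall delta eta : R, 0 < delta < 1 -> 0 < eta < 1 ->
     exists (Theta : nat) (eps : R) (sigmahat : 'M[R[i]]_(a ^ 1)),
       [/\ covering_code rho N 1 Theta eps sigmahat,
           ((log2 Theta%:R)%:E <=
              pospart (- Hmin_smooth delta (channel_output N Phi)
                       - (2 * log2 eta)%:E))%E
         & eps <= 8 * (delta + eta)]) /\
  (forall eps : R, 0 < eps < 1 ->
     forall (Theta : nat) (sigmahat : 'M[R[i]]_(a ^ 1)),
     covering_code rho N 1 Theta eps sigmahat ->
     forall Phi : 'M[R[i]]_a -> 'M[R[i]]_(a * a),
     (forall sigma, approx_preimage_states (2 * eps) rho N sigma ->
        purification sigma (Phi sigma)) ->
     (ereal_inf [set pospart (- Hmin (channel_output N (Phi sigma)))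
                | sigma in approx_preimage_states (2 * eps) rho N]
        <= (log2 Theta%:R)%:E)%E).
Proof.
split.
  move=> sigma Phi pre pu delta eta d01 e01.
  have [S [dS HS eS]] := covering_achievability hN hrho pre pu d01 e01.
  (* The bound itself serves as the error; at n = 1 tensor powers are convertible to the one-copy
     objects. *)
  by exists (\rank S), (8 * (delta + eta)), S; split.
move=> eps _ Theta S [dS <- eS] Phi puPhi.
(* The factor 1/2 in the code error becomes the tolerance 2 eps in trace norm. *)
have aS : approx_preimage_states (2 * eps) rho N S.
  by split=> //; move: eS; rewrite ler_pdivrMl // mulrC.
apply: le_trans (covering_converse hN dS (puPhi _ aS)).
by apply: ereal_inf_lbound; exists S.
Qed.
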